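(* The forgetful functors $$G:\mathcal{C}^*_1\to \mathrm{BanAlg}^*_1\quad\text{and}\quad G_c:\mathcal{C}^*_{c,1}\to \mathrm{BanAlg}^*_{c,1}$$ from unital (respectively unital commutative) $C^*$-algebras to unital (respectively unital commutative) Banach $*$-algebras both satisfy the Crude Tripleability Theorem (CTT), and hence are monadic.
   Context: $\mathcal{C}^*_1$ (resp. $\mathcal{C}^*_{c,1}$) is the category of unital (resp. unital commutative) complex $C^*$-algebras with unital $*$-homomorphisms; the zero algebra is allowed. $\mathrm{BanAlg}^*_1$ (resp. $\mathrm{BanAlg}^*_{c,1}$) is the category of unital (resp. unital commutative) complex Banach algebras with isometric involution, with unital contractive (norm $\le 1$) $*$-homomorphisms as morphisms; the zero algebra is allowed. A pair of parallel morphisms $\partial_0,\partial_1:A\to B$ is reflexive if there is $t:B\to A$ with $\partial_0t=\mathrm{id}_B=\partial_1t$. A functor $G:\mathcal{C}\to\mathcal{D}$ satisfies the Crude Tripleability Theorem (is CTT) if: (1) $G$ has a left adjoint; (2) $G$ reflects isomorphisms; (3) $\mathcal{C}$ has coequalizers for those reflexive pairs $(\partial_0,\partial_1)$ for which $(G\partial_0,G\partial_1)$ has a coequalizer, and $G$ preserves those coequalizers. A functor $G:\mathcal{C}\to\mathcal{D}$ with left adjoint $F$ is monadic if the canonical comparison functor from $\mathcal{C}$ to the Eilenberg-Moore category of algebras over the monad $GF$ on $\mathcal{D}$ is an equivalence. *)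

(* Defs.v *)
From HB Require Import structures.
From mathcomp Require Import all_boot all_order all_algebra.
From mathcomp Require Import complex.
From mathcomp Require Import boolp classical_sets reals topology normedtype.
From mathcomp Require Import sequences.
From mathcomp Require Import ring.

Set Implicit Arguments.
Unset Strict Implicit.
Unset Printing Implicit Defensive.

Import Order.TTheory GRing.Theory Num.Theory.
Import numFieldNormedType.Exports.

Local Open Scope ring_scope.

(* A ring structure cannot be joined to completeNormedModType (the library
   reserves the join of rings and normed groups for numDomainType), so the
   product and the unit are fields of the mixin.  They may be degenerate: the
   zero algebra is allowed.  For the same reason the normalisation |1| = 1
   reads |1| <= 1: together with |1| <= |1|^2 it means that |1| = 1 or 1 = 0. *)
HB.mixin Record isBanachStarAlgebra (K : numClosedFieldType) A
    of CompleteNormedModule K A := {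
  bmul : A -> A -> A;
  bone : A;
  star : A -> A;
  bmulA : associative bmul;
  bmul1x : left_id bone bmul;
  bmulx1 : right_id bone bmul;
  bmulDl : left_distributive bmul +%R;
  bmulDr : right_distributive bmul +%R;
  bmulZl : forall (c : K) (x y : A), bmul (c *: x) y = c *: bmul x y;
  bmulZr : forall (c : K) (x y : A), bmul x (c *: y) = c *: bmul x y;
  bnormM : forall x y : A, `|bmul x y| <= `|x| * `|y|;
  bnorm1 : `|bone| <= 1;
  starK : involutive star;
  starD : {morph star : x y / x + y};
  starZ : forall (c : K) (x : A), star (c *: x) = Num.conj c *: star x;
  starM : forall x y : A, star (bmul x y) = bmul (star y) (star x);
  norm_star : forall x : A, `|star x| = `|x|
}.

#[short(type="banachStarAlgType")]
HB.structure Definition BanachStarAlgebra (K : numClosedFieldType) :=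
  {A of CompleteNormedModule K A & isBanachStarAlgebra K A}.

Notation "x ** y" := (bmul x y) (at level 40, left associativity) : ring_scope.

HB.mixin Record hasCStarIdentity (K : numClosedFieldType) A
    of BanachStarAlgebra K A := {
  cstar_identity : forall x : A, `|star x ** x| = `|x| ^+ 2
}.

#[short(type="cstarAlgType")]
HB.structure Definition CStarAlgebra (K : numClosedFieldType) :=
  {A of BanachStarAlgebra K A & hasCStarIdentity K A}.

Definition is_star_hom (K : numClosedFieldType) (A B : banachStarAlgType K)
    (f : A -> B) : Prop :=
  [/\ linear f, f bone = bone, {morph f : x y / x ** y}
    & {morph f : x / star x}].

Definition contractive (K : numClosedFieldType) (A B : banachStarAlgType K)
    (f : A -> B) : Prop :=
  forall x : A, `|f x| <= `|x|.

Definition alg_commutative (K : numClosedFieldType) (A : banachStarAlgType K) :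
  Prop := commutative (@bmul K A).

Section SquareRoot.
Variables (R : realType) (A : banachStarAlgType R[i]).
Implicit Types x y z : A.

Lemma bmul0x x : 0 ** x = 0.
Proof. by rewrite -(scale0r x) bmulZl !scale0r. Qed.

Lemma bmulx0 x : x ** 0 = 0.
Proof. by rewrite -(scale0r x) bmulZr !scale0r. Qed.

Lemma bmulNx x y : (- x) ** y = - (x ** y).
Proof. by rewrite -scaleN1r bmulZl scaleN1r. Qed.

Lemma bmulxN x y : x ** (- y) = - (x ** y).
Proof. by rewrite -scaleN1r bmulZr scaleN1r. Qed.

Lemma star0 : star (0 : A) = 0.
Proof. by rewrite -(scale0r (0 : A)) starZ rmorph0 !scale0r. Qed.

Lemma starN x : star (- x) = - star x.
Proof. by rewrite -scaleN1r starZ rmorphN1 scaleN1r. Qed.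

Lemma star1 : star (bone : A) = bone.
Proof. by rewrite -[LHS]bmulx1 -[X in _ ** X]starK -starM bmulx1 starK. Qed.

Lemma expr_small (r e : R[i]) : 0 <= r -> r < 1 -> 0 < e ->
  exists n, r ^+ n < e.
Proof.
move=> r0 r1 e0.
have rE : r = (complex.Re r)%:C%C.
  by case: r r0 {r1} => a b /=; rewrite lecE /= => /andP[/eqP-> _].
have eE : e = (complex.Re e)%:C%C.
  by case: e e0 => a b /=; rewrite ltcE /= => /andP[/eqP-> _].
move: r0 r1 e0; rewrite rE eE -[1]/(1%:C%C) -[0]/(0%:C%C) !ltcR lecR => r0 r1 e0.
have nr : `|complex.Re r| < 1 by rewrite ger0_norm.
move/cvgrPdist_lt: (cvg_expr nr) => /(_ _ e0)[n _ /(_ n (leqnn n)) /=].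
by rewrite sub0r normrN ger0_norm ?exprn_ge0// => rn; exists n; rewrite -rmorphXn ltcR.
Qed.

Lemma eps_eq0 x (c : R[i]) :
  0 <= c -> (forall e, 0 < e -> `|x| <= c * e) -> x = 0.
Proof.
move=> c0 xe; apply/normr0_eq0/le_anti/andP; split=> //.
apply/ler_addgt0Pr => e e0; rewrite add0r.
have c1 : 0 < c + 1 by rewrite ltr_wpDl.
apply: le_trans (xe (e / (c + 1)) (divr_gt0 e0 c1)) _.
by rewrite mulrCA ler_piMr ?(ltW e0)// ler_pdivrMr// mul1r lerDl.
Qed.

(* The square root of 1 - a is 1 - z, where z is the fixed point of
   z |-> (a + z^2) / 2 *)
Variable a : A.
Let r := `|a|.
Hypothesis r1 : r < 1.
Let half : R[i] := 2^-1.
Let u n : A := iter n (fun z => half *: (a + z ** z)) 0.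

Let r0 : 0 <= r. Proof. exact: normr_ge0. Qed.

Let normhalf : `|half| = half.
Proof. by rewrite ger0_norm// invr_ge0. Qed.

Let halfD : half + half = 1.
Proof. by rewrite /half; field. Qed.

Let u_le n : `|u n| <= r.
Proof.
elim: n => [|n IHn]; first by rewrite normr0.
rewrite [u _]/= normrZ normhalf.
rewrite -[leRHS]mul1r -halfD mulrDl -mulrDr ler_wpM2l ?invr_ge0//.
apply: (le_trans (ler_normD _ _)); rewrite lerD2l.
apply: (le_trans (bnormM _ _)); rewrite -[leRHS]mulr1.
by rewrite ler_pM// (le_trans IHn) ?ltW.
Qed.

Let sqrB x y : x ** x - y ** y = x ** (x - y) + (x - y) ** y.
Proof. by rewrite bmulDr bmulDl bmulxN bmulNx addrA subrK. Qed.

Let norm_sqrB x y (d : R[i]) : `|x| <= r -> `|y| <= r -> `|x - y| <= d ->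
  `|half *: (x ** x - y ** y)| <= r * d.
Proof.
move=> xr yr xyd; rewrite normrZ normhalf sqrB.
have -> : r * d = half * (r * d + d * r) by rewrite [d * r]mulrC mulrDr -mulrDl halfD mul1r.
rewrite ler_wpM2l ?invr_ge0//; apply: (le_trans (ler_normD _ _)).
by apply: lerD; apply: (le_trans (bnormM _ _)); apply: ler_pM.
Qed.

Let u_cauchy n m : `|u (n + m) - u n| <= r ^+ n.
Proof.
elim: n => [|n IHn].
  by rewrite subr0 (le_trans (u_le _)) ?ltW.
rewrite [u (n.+1 + m)]/= [u n.+1]/= -scalerBr opprD addrACA subrr add0r exprS.
exact: norm_sqrB.
Qed.

Lemma sqrt_limit : exists z : A,
  `|z| <= r /\ forall e : R[i], 0 < e ->
  exists n, `|u n - z| <= e /\ `|u n.+1 - z| <= e.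
Proof.
have : cauchy (u @ \oo)%classic.
  apply/cauchy_exP => e e0.
  have [n rn] := expr_small r0 r1 e0.
  exists (u n); exists n => //= m nm; rewrite -ball_normE /=.
  by rewrite distrC -(subnKC nm) (le_lt_trans (u_cauchy _ _)).
move=> /cauchy_cvg /cvg_ex[z uz].
have uz' e : 0 < e -> exists n, `|u n - z| <= e /\ `|u n.+1 - z| <= e.
  move=> e0; move/cvgrPdist_le: uz => /(_ e e0)[n _ zu].
  by exists n; split; rewrite distrC; apply: zu => /=.
exists z; split => //; apply/ler_addgt0Pr => e /uz'[n [une _]].
rewrite -[z](subrK (u n)) addrC (le_trans (ler_normD _ _))//.
by apply: lerD; [exact: u_le | rewrite distrC].
Qed.

Lemma sqrt_exists : star a = a -> exists y : A,
  [/\ y ** y = bone - a, star y = y & forall h, h ** a = a ** h ->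
      h ** y = y ** h].
Proof.
move=> sa; have [z [zr uz]] := sqrt_limit.
have u_star n : star (u n) = u n.
  elim: n => [|n IHn]; first exact: star0.
  by rewrite [u _]/= starZ starD starM IHn sa fmorphV /= rmorph_nat.
have u_comm h n : h ** a = a ** h -> h ** u n = u n ** h.
  move=> ha; elim: n => [|n IHn]; first by rewrite bmul0x bmulx0.
  by rewrite [u _]/= bmulZr bmulZl bmulDr bmulDl ha bmulA IHn -bmulA IHn bmulA.
have z_star : star z = z.
  apply/eqP; rewrite -subr_eq0; apply/eqP/(@eps_eq0 _ 2) => // e /uz[n [une _]].
  have -> : star z - z = star (z - u n) + (u n - z).
    by rewrite starD starN u_star addrA subrK.
  rewrite (le_trans (ler_normD _ _))// norm_star distrC.
  by rewrite mulr_natl mulr2n lerD.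
have z_comm h : h ** a = a ** h -> h ** z = z ** h.
  move=> ha; apply/eqP; rewrite -subr_eq0; apply/eqP.
  apply: (@eps_eq0 _ (`|h| + `|h|)) => [|e /uz[n [une _]]]; first exact: addr_ge0.
  have -> : h ** z - z ** h = (u n - z) ** h - h ** (u n - z).
    rewrite bmulDl bmulDr bmulNx bmulxN (u_comm h n ha).
    by rewrite opprD opprK addrACA subrr add0r addrC.
  rewrite (le_trans (ler_normB _ _))// mulrDl.
  apply: lerD; apply: (le_trans (bnormM _ _)); last by rewrite ler_wpM2l.
  by rewrite mulrC ler_wpM2l.
have z_fix : z = half *: (a + z ** z).
  apply/eqP; rewrite -subr_eq0; apply/eqP.
  apply: (@eps_eq0 _ (1 + r)) => [|e /uz[n [une uSe]]]; first exact: addr_ge0.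
  have -> : z - half *: (a + z ** z)
      = (z - u n.+1) + half *: (u n ** u n - z ** z).
    by rewrite [u n.+1]/= !scalerDr scalerN !opprD !addrA addrNK.
  rewrite (le_trans (ler_normD _ _))// mulrDl mul1r lerD ?norm_sqrB//.
  by rewrite distrC.
have z_fix2 : z + z = a + z ** z.
  by rewrite {1 2}z_fix -scalerDl halfD scale1r.
exists (bone - z); split.
- rewrite bmulDl bmul1x bmulDr bmulx1 bmulxN bmulNx opprK.
  rewrite addrA -[bone - z - z]addrA -opprD z_fix2 opprD addrA.
  by rewrite subrK.
- by rewrite starD starN star1 z_star.
- by move=> h /z_comm hz; rewrite bmulDr bmulDl bmulxN bmulNx bmul1x bmulx1 hz.
Qed.

End SquareRoot.

Lemma star_hom_contractive (R : realType) (A : banachStarAlgType R[i])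
    (B : cstarAlgType R[i]) (f : A -> B) : is_star_hom f -> contractive f.
Proof.
move=> [flin f1 fM fS].
have f0 : f 0 = 0.
  by have := flin (- 1) 0 0; rewrite scaler0 addr0 scaleN1r addNr.
have fZ c x : f (c *: x) = c *: f x.
  by rewrite -[c *: x]addr0 flin f0 addr0.
have fD x y : f (x + y) = f x + f y by rewrite -[x]scale1r flin !scale1r.
(* If h is self-adjoint with |h| < 1 and y^2 = 1 - h^2, then f h is the real
   part of the unitary f h + i f y. *)
have sa_le1 (h : A) : star h = h -> `|h| < 1 -> `|f h| <= 1.
  move=> sh h1.
  have hh1 : `|h ** h| < 1.
    apply: (le_lt_trans (bnormM _ _)).
    by rewrite (le_lt_trans _ h1)// ler_piMr// ltW.
  have [|y [yy sy yc]] := sqrt_exists hh1; first by rewrite starM sh.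
  have {yc} hy : h ** y = y ** h by apply: yc; rewrite bmulA.
  pose k := f h; pose w := f y.
  have sk : star k = k by rewrite /k -fS sh.
  have sw : star w = w by rewrite /w -fS sy.
  have kw : k ** w = w ** k by rewrite /k /w -!fM hy.
  have kkww : k ** k + w ** w = bone.
    by rewrite /k /w -!fM yy -fD addrC subrK f1.
  have unit_le1 (c : R[i]) : Num.conj c = - c -> c * c = -1 ->
      `|k + c *: w| <= 1.
    move=> cN cc; rewrite -(@expr_le1 _ 2)// -cstar_identity starD starZ.
    rewrite sk sw cN bmulDl !bmulDr !bmulZl !bmulZr scalerA mulNr cc opprK.
    by rewrite scale1r kw scaleNr addrA addrK kkww bnorm1.
  have -> : f h = 2^-1 *: ((k + 'i *: w) + (k + (- 'i) *: w)).
    rewrite addrACA scaleNr subrr addr0.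
    have -> : k + k = (2 : R[i]) *: k by rewrite scaler_nat mulr2n.
    by rewrite scalerA mulVf ?scale1r// pnatr_eq0.
  rewrite normrZ ger0_norm ?invr_ge0// ler_pdivrMl// mulr1.
  apply: (le_trans (ler_normD _ _)).
  rewrite -[leRHS]/(1 + 1 : R[i]).
  apply: lerD; apply: unit_le1.
  - exact: conjCi.
  - by rewrite -expr2 sqrCi.
  - by rewrite rmorphN /= conjCi.
  - by rewrite mulrNN -expr2 sqrCi.
move=> x; apply/ler_addgt0Pr => e e0.
pose c := `|x| + e.
have c0 : 0 < c by rewrite ltr_wpDl.
have cV0 : 0 <= c^-1 by rewrite invr_ge0 ltW.
have xc : `|c^-1 *: x| < 1.
  by rewrite normrZ ger0_norm// ltr_pdivrMl// mulr1 ltrDl.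
pose y := c^-1 *: x.
suff : `|f y| <= 1 by rewrite fZ normrZ ger0_norm// ler_pdivrMl// mulr1.
rewrite -(@expr_le1 _ 2)// -cstar_identity -fS -fM.
apply: sa_le1; first by rewrite starM starK.
apply: (le_lt_trans (bnormM _ _)); rewrite norm_star.
by rewrite (le_lt_trans _ xc)// ler_piMr// ltW.
Qed.

Record category := Category {
  ob :> Type;
  hom : ob -> ob -> Type;
  idm : forall A, hom A A;
  compm : forall A B C, hom B C -> hom A B -> hom A C;
  compmA : forall A B C D (h : hom C D) (g : hom B C) (f : hom A B),
    compm h (compm g f) = compm (compm h g) f;
  comp1m : forall A B (f : hom A B), compm (idm B) f = f;
  compm1 : forall A B (f : hom A B), compm f (idm A) = f
}.
Arguments idm {c} A.

Declare Scope cat_scope.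
Delimit Scope cat_scope with cat.
Local Open Scope cat_scope.
Notation "g \c f" := (compm g f) (at level 50, left associativity) : cat_scope.

Definition is_iso (C : category) (A B : C) (f : hom A B) : Prop :=
  exists g : hom B A, g \c f = idm A /\ f \c g = idm B.

Definition is_coequalizer (C : category) (A B : C) (d0 d1 : hom A B)
    (Q : C) (q : hom B Q) : Prop :=
  q \c d0 = q \c d1 /\
  forall (X : C) (f : hom B X), f \c d0 = f \c d1 ->
    exists! g : hom Q X, g \c q = f.

Definition has_coequalizer (C : category) (A B : C) (d0 d1 : hom A B) : Prop :=
  exists (Q : C) (q : hom B Q), is_coequalizer d0 d1 q.

Definition reflexive_pair (C : category) (A B : C) (d0 d1 : hom A B) : Prop :=
  exists t : hom B A, d0 \c t = idm B /\ d1 \c t = idm B.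

Section FullSubcategory.
Variables (C : category) (P : C -> Prop).

Definition full_subcategory : category :=
  @Category {A : C | P A} (fun A B => hom (sval A) (sval B))
    (fun A => idm (sval A)) (fun A B D g f => g \c f)
    (fun A B D E h g f => compmA h g f)
    (fun A B f => comp1m f) (fun A B f => compm1 f).

End FullSubcategory.

Record functor (C D : category) := Functor {
  fob :> C -> D;
  fmap : forall A B : C, hom A B -> hom (fob A) (fob B);
  fmap1 : forall A : C, fmap (idm A) = idm (fob A);
  fmapM : forall (A B E : C) (g : hom B E) (f : hom A B),
    fmap (g \c f) = fmap g \c fmap f
}.
Arguments fmap {C D} _ {A B} _.

Definition idfun_cat (C : category) : functor C C :=
  @Functor C C id (fun A B f => f) (fun A => erefl) (fun A B E g f => erefl).

Section FunctorComposition.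
Variables (C D E : category) (G : functor D E) (F : functor C D).

Fact fcomp_map1 (A : C) : fmap G (fmap F (idm A)) = idm (G (F A)).
Proof. by rewrite !fmap1. Qed.

Fact fcomp_mapM (A B X : C) (g : hom B X) (f : hom A B) :
  fmap G (fmap F (g \c f)) = fmap G (fmap F g) \c fmap G (fmap F f).
Proof. by rewrite !fmapM. Qed.

Definition fcomp : functor C E :=
  @Functor C E (fun A => G (F A)) (fun A B f => fmap G (fmap F f))
    fcomp_map1 fcomp_mapM.

End FunctorComposition.
Notation "G \F F" := (fcomp G F) (at level 50, left associativity) : cat_scope.

Definition restrict_functor (C D : category) (G : functor C D)
    (P : C -> Prop) (Q : D -> Prop) (PQ : forall A : C, P A -> Q (G A)) :
    functor (full_subcategory P) (full_subcategory Q) :=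
  @Functor (full_subcategory P) (full_subcategory Q)
    (fun A => exist Q (G (sval A)) (PQ _ (svalP A)))
    (fun A B f => fmap G f)
    (fun A => fmap1 G (sval A)) (fun A B E g f => fmapM G g f).

Record nattrans (C D : category) (F G : functor C D) := Nattrans {
  ntob :> forall A : C, hom (F A) (G A);
  ntE : forall (A B : C) (f : hom A B), fmap G f \c ntob A = ntob B \c fmap F f
}.

Definition naturally_isomorphic (C D : category) (F G : functor C D) : Prop :=
  exists a : nattrans F G, forall A : C, is_iso (a A).

Definition is_equivalence (C D : category) (K : functor C D) : Prop :=
  exists L : functor D C, naturally_isomorphic (L \F K) (idfun_cat C) /\
                          naturally_isomorphic (K \F L) (idfun_cat D).

Record adjunction (C D : category) (F : functor D C) (G : functor C D) :=
  Adjunction {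
    adj_unit : nattrans (idfun_cat D) (G \F F);
    adj_counit : nattrans (F \F G) (idfun_cat C);
    adj_triangleF : forall X : D,
      adj_counit (F X) \c fmap F (adj_unit X) = idm (F X);
    adj_triangleG : forall A : C,
      fmap G (adj_counit A) \c adj_unit (G A) = idm (G A)
  }.

Definition has_left_adjoint (C D : category) (G : functor C D) : Prop :=
  exists F : functor D C, inhabited (adjunction F G).

Record monad (D : category) := Monad {
  mfun :> functor D D;
  munit : nattrans (idfun_cat D) mfun;
  mmul : nattrans (mfun \F mfun) mfun;
  mmulA : forall X : D, mmul X \c fmap mfun (mmul X) = mmul X \c mmul (mfun X);
  mmul1m : forall X : D, mmul X \c munit (mfun X) = idm (mfun X);
  mmulm1 : forall X : D, mmul X \c fmap mfun (munit X) = idm (mfun X)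
}.
Arguments munit {D} _.
Arguments mmul {D} _.

Section EilenbergMoore.
Variables (D : category) (T : monad D).

Record em_algebra := EMAlgebra {
  em_ob : D;
  em_act : hom (T em_ob) em_ob;
  em_act_unit : em_act \c munit T em_ob = idm em_ob;
  em_act_mul : em_act \c fmap T em_act = em_act \c mmul T em_ob
}.

Definition em_hom (X Y : em_algebra) :=
  {f : hom (em_ob X) (em_ob Y) | f \c em_act X = em_act Y \c fmap T f}.

Lemma em_hom_inj (X Y : em_algebra) (f g : em_hom X Y) :
  sval f = sval g -> f = g.
Proof.
by case: f g => f fP [g gP] /= fg; subst g; rewrite (Prop_irrelevance fP gP).
Qed.

Fact em_id_subproof (X : em_algebra) :
  idm (em_ob X) \c em_act X = em_act X \c fmap T (idm (em_ob X)).
Proof. by rewrite fmap1 comp1m compm1. Qed.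

Definition em_id (X : em_algebra) : em_hom X X := exist _ _ (em_id_subproof X).

Fact em_comp_subproof (X Y Z : em_algebra) (g : em_hom Y Z) (f : em_hom X Y) :
  (sval g \c sval f) \c em_act X = em_act Z \c fmap T (sval g \c sval f).
Proof.
by rewrite fmapM -compmA (svalP f) compmA (svalP g) compmA.
Qed.

Definition em_comp (X Y Z : em_algebra) (g : em_hom Y Z) (f : em_hom X Y) :
  em_hom X Z := exist _ _ (em_comp_subproof g f).

Fact em_compA (X Y Z W : em_algebra)
    (h : em_hom Z W) (g : em_hom Y Z) (f : em_hom X Y) :
  em_comp h (em_comp g f) = em_comp (em_comp h g) f.
Proof. exact/em_hom_inj/compmA. Qed.

Fact em_comp1m (X Y : em_algebra) (f : em_hom X Y) : em_comp (em_id Y) f = f.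
Proof. exact/em_hom_inj/comp1m. Qed.

Fact em_compm1 (X Y : em_algebra) (f : em_hom X Y) : em_comp f (em_id X) = f.
Proof. exact/em_hom_inj/compm1. Qed.

Definition em_category : category :=
  @Category em_algebra em_hom em_id em_comp em_compA em_comp1m em_compm1.

End EilenbergMoore.

Section Comparison.
Variables (C D : category) (F : functor D C) (G : functor C D).
Variable adj : adjunction F G.
Let eta := adj_unit adj.
Let eps := adj_counit adj.

Fact adj_mul_nat (X Y : D) (f : hom X Y) :
  fmap (G \F F) f \c fmap G (eps (F X)) =
  fmap G (eps (F Y)) \c fmap ((G \F F) \F (G \F F)) f.
Proof. by rewrite /= -!fmapM (ntE eps (fmap F f)). Qed.

Definition adj_mul : nattrans ((G \F F) \F (G \F F)) (G \F F) :=
  @Nattrans D D ((G \F F) \F (G \F F)) (G \F F)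
    (fun X => fmap G (eps (F X))) adj_mul_nat.

Fact adj_mulA (X : D) :
  adj_mul X \c fmap (G \F F) (adj_mul X) = adj_mul X \c adj_mul ((G \F F) X).
Proof. by rewrite /= -!fmapM -(ntE eps (eps (F X))). Qed.

Fact adj_mul1m (X : D) : adj_mul X \c eta ((G \F F) X) = idm ((G \F F) X).
Proof. exact (adj_triangleG adj (F X)). Qed.

Fact adj_mulm1 (X : D) : adj_mul X \c fmap (G \F F) (eta X) = idm ((G \F F) X).
Proof. by rewrite /= -fmapM adj_triangleF fmap1. Qed.

Definition adj_monad : monad D :=
  @Monad D (G \F F) eta adj_mul adj_mulA adj_mul1m adj_mulm1.

Fact comparison_act_mul (A : C) :
  fmap G (eps A) \c fmap adj_monad (fmap G (eps A)) =
  fmap G (eps A) \c mmul adj_monad (G A).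
Proof. by rewrite /= -!fmapM -(ntE eps (eps A)). Qed.

Definition comparison_ob (A : C) : em_algebra adj_monad :=
  @EMAlgebra D adj_monad (G A) (fmap G (eps A)) (adj_triangleG adj A)
    (comparison_act_mul A).

Fact comparison_hom_subproof (A B : C) (f : hom A B) :
  fmap G f \c em_act (comparison_ob A) =
  em_act (comparison_ob B) \c fmap adj_monad (fmap G f).
Proof. by rewrite /= -!fmapM (ntE eps f). Qed.

Definition comparison_hom (A B : C) (f : hom A B) :
  em_hom (comparison_ob A) (comparison_ob B) :=
  exist _ _ (comparison_hom_subproof f).

Fact comparison_hom1 (A : C) : comparison_hom (idm A) = em_id (comparison_ob A).
Proof. exact/em_hom_inj/fmap1. Qed.

Fact comparison_homM (A B E : C) (g : hom B E) (f : hom A B) :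
  comparison_hom (g \c f) = em_comp (comparison_hom g) (comparison_hom f).
Proof. exact/em_hom_inj/fmapM. Qed.

Definition comparison : functor C (em_category adj_monad) :=
  @Functor C (em_category adj_monad) comparison_ob comparison_hom
    comparison_hom1 comparison_homM.

End Comparison.

Definition reflects_isomorphisms (C D : category) (G : functor C D) : Prop :=
  forall (A B : C) (f : hom A B), is_iso (fmap G f) -> is_iso f.

Definition CTT (C D : category) (G : functor C D) : Prop :=
  [/\ has_left_adjoint G,
      reflects_isomorphisms G &
      forall (A B : C) (d0 d1 : hom A B), reflexive_pair d0 d1 ->
        has_coequalizer (fmap G d0) (fmap G d1) ->
        has_coequalizer d0 d1 /\
        forall (Q : C) (q : hom B Q), is_coequalizer d0 d1 q ->
          is_coequalizer (fmap G d0) (fmap G d1) (fmap G q)].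

(* The comparison functor is required to be an equivalence for every choice
   of the left adjoint and of the adjunction. *)
Definition monadic (C D : category) (G : functor C D) : Prop :=
  has_left_adjoint G /\
  forall (F : functor D C) (adj : adjunction F G),
    is_equivalence (comparison adj).

Lemma is_star_hom_id (K : numClosedFieldType) (A : banachStarAlgType K) :
  is_star_hom (@id A).
Proof. by []. Qed.

Lemma is_star_hom_comp (K : numClosedFieldType) (A B D : banachStarAlgType K)
    (g : B -> D) (f : A -> B) :
  is_star_hom g -> is_star_hom f -> is_star_hom (g \o f).
Proof.
move=> [gl g1 gM gS] [fl f1 fM fS]; split=> /=.
- by move=> c x y /=; rewrite fl gl.
- by rewrite f1 g1.
- by move=> x y /=; rewrite fM gM.
- by move=> x /=; rewrite fS gS.
Qed.

Lemma contractive_comp (K : numClosedFieldType) (A B D : banachStarAlgType K)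
    (g : B -> D) (f : A -> B) :
  contractive g -> contractive f -> contractive (g \o f).
Proof. by move=> gc fc x; apply: le_trans (gc _) (fc _). Qed.

Section CStarCategory.
Variable R : realType.

Definition cstar_hom (A B : cstarAlgType R[i]) :=
  {f : A -> B | is_star_hom f}.

Lemma cstar_hom_inj (A B : cstarAlgType R[i]) (f g : cstar_hom A B) :
  sval f = sval g -> f = g.
Proof.
by case: f g => f fP [g gP] /= fg; subst g; rewrite (Prop_irrelevance fP gP).
Qed.

Definition cstar_id (A : cstarAlgType R[i]) : cstar_hom A A :=
  exist _ id (is_star_hom_id A).

Definition cstar_comp (A B D : cstarAlgType R[i]) (g : cstar_hom B D)
    (f : cstar_hom A B) : cstar_hom A D :=
  exist _ (sval g \o sval f) (is_star_hom_comp (svalP g) (svalP f)).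

Fact cstar_compA (A B D E : cstarAlgType R[i]) (h : cstar_hom D E)
    (g : cstar_hom B D) (f : cstar_hom A B) :
  cstar_comp h (cstar_comp g f) = cstar_comp (cstar_comp h g) f.
Proof. exact: cstar_hom_inj. Qed.

Fact cstar_comp1m (A B : cstarAlgType R[i]) (f : cstar_hom A B) :
  cstar_comp (cstar_id B) f = f.
Proof. exact: cstar_hom_inj. Qed.

Fact cstar_compm1 (A B : cstarAlgType R[i]) (f : cstar_hom A B) :
  cstar_comp f (cstar_id A) = f.
Proof. exact: cstar_hom_inj. Qed.

Definition CStar1 : category :=
  @Category (cstarAlgType R[i]) cstar_hom cstar_id cstar_comp
    cstar_compA cstar_comp1m cstar_compm1.

Definition CStarc1 : category :=
  full_subcategory (fun A : CStar1 => alg_commutative A).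

End CStarCategory.

Section BanachStarCategory.
Variable R : realType.

Definition banstar_hom (A B : banachStarAlgType R[i]) :=
  {f : A -> B | is_star_hom f /\ contractive f}.

Lemma banstar_hom_inj (A B : banachStarAlgType R[i]) (f g : banstar_hom A B) :
  sval f = sval g -> f = g.
Proof.
by case: f g => f fP [g gP] /= fg; subst g; rewrite (Prop_irrelevance fP gP).
Qed.

Definition banstar_id (A : banachStarAlgType R[i]) : banstar_hom A A :=
  exist _ id (conj (is_star_hom_id A) (fun x => lexx `|x|)).

Definition banstar_comp (A B D : banachStarAlgType R[i]) (g : banstar_hom B D)
    (f : banstar_hom A B) : banstar_hom A D :=
  exist _ (sval g \o sval f)
    (conj (is_star_hom_comp (svalP g).1 (svalP f).1)
          (contractive_comp (svalP g).2 (svalP f).2)).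

Fact banstar_compA (A B D E : banachStarAlgType R[i]) (h : banstar_hom D E)
    (g : banstar_hom B D) (f : banstar_hom A B) :
  banstar_comp h (banstar_comp g f) = banstar_comp (banstar_comp h g) f.
Proof. exact: banstar_hom_inj. Qed.

Fact banstar_comp1m (A B : banachStarAlgType R[i]) (f : banstar_hom A B) :
  banstar_comp (banstar_id B) f = f.
Proof. exact: banstar_hom_inj. Qed.

Fact banstar_compm1 (A B : banachStarAlgType R[i]) (f : banstar_hom A B) :
  banstar_comp f (banstar_id A) = f.
Proof. exact: banstar_hom_inj. Qed.

Definition BanAlgStar1 : category :=
  @Category (banachStarAlgType R[i]) banstar_hom banstar_id banstar_comp
    banstar_compA banstar_comp1m banstar_compm1.

Definition BanAlgStarc1 : category :=
  full_subcategory (fun A : BanAlgStar1 => alg_commutative A).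

End BanachStarCategory.

Section ForgetfulFunctors.
Variable R : realType.

Definition forget_ob (A : CStar1 R) : BanAlgStar1 R :=
  (A : cstarAlgType R[i]) : banachStarAlgType R[i].

(* *-homomorphisms into C*-algebras are automatically contractive *)
Definition forget_hom (A B : CStar1 R) (f : hom A B) :
    hom (forget_ob A) (forget_ob B) :=
  exist _ (sval f) (conj (svalP f) (star_hom_contractive (svalP f))).

Fact forget_hom1 (A : CStar1 R) : forget_hom (idm A) = idm (forget_ob A).
Proof. exact: banstar_hom_inj. Qed.

Fact forget_homM (A B D : CStar1 R) (g : hom B D) (f : hom A B) :
  forget_hom (g \c f) = forget_hom g \c forget_hom f.
Proof. exact: banstar_hom_inj. Qed.

Definition forget : functor (CStar1 R) (BanAlgStar1 R) :=
  @Functor (CStar1 R) (BanAlgStar1 R) forget_ob forget_hom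
    forget_hom1 forget_homM.

Definition forget_c : functor (CStarc1 R) (BanAlgStarc1 R) :=
  restrict_functor (G := forget) (fun A commA => commA).

End ForgetfulFunctors.

(* Main.v *)
(* A *-homomorphism into a C*-algebra is contractive, so G is fully faithful.
   Hence it reflects isomorphisms, the monad GF is idempotent, and G is monadic
   as soon as it has a left adjoint F.  For the latter, F B is the completion of
   B with respect to its largest C*-seminorm dominated by the norm.

   For a reflexive pair d0, d1 : A -> B of C*-algebras the differences
   d0 a - d1 a form a *-ideal J, and the coequalizer of Banach *-algebras is the
   completion of B for the quotient seminorm of J.  It remains to see that this
   seminorm satisfies the C*-identity (Segal).  Let j in J be self-adjoint with
   |j| < 1 and put y = sqrt(1 - j^2).  Then u = j + i y is unitary, so
   j y = (u^2 - u^*^2) / 4i has norm at most 1/2, and m = y^2 satisfies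
   1 - m = j^2 in J, |m| <= 1 and |m j m| <= 1/2.  Iterating, every self-adjoint
   j in J has contractions m, equal to 1 modulo J, with |m^* j m| as small as we
   like, and |x m|^2 = |m^* x^* x m| <= |x^* x + j| + |m^* j m|. *)

From Pilot Require Import Defs.
From HB Require Import structures.
From mathcomp Require Import all_boot all_order all_algebra.
From mathcomp Require Import complex reals topology normedtype.
From mathcomp Require Import boolp classical_sets functions sequences ring lra.
(* The vector library also defines [hom]. *)
Import Pilot.Defs.

Set Implicit Arguments.
Unset Strict Implicit.
Unset Printing Implicit Defensive.

Import Order.TTheory GRing.Theory Num.Theory.
Import numFieldNormedType.Exports.

Local Open Scope ring_scope.

(** * Reflective subcategories *)

Section UniversalArrows.
Local Open Scope cat_scope.
Variables (C D : category) (G : functor C D).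

Definition universal_arrow (X : D) (FX : C) (eta : hom X (G FX)) : Prop :=
  forall (A : C) (f : hom X (G A)), exists! g : hom FX A, fmap G g \c eta = f.

(** A choice of universal arrows gives the left adjoint on objects. Uniqueness of factorisations
    then yields everything else: functoriality, naturality of the counit and the triangle identity
    on the side of the left adjoint. *)
Lemma universal_arrows_left_adjoint :
  (forall X : D, exists (FX : C) (eta : hom X (G FX)), universal_arrow eta) ->
  has_left_adjoint G.
Proof.
move=> univ.
have {univ} arrow X : {FX : C & {eta : hom X (G FX) | universal_arrow eta}}.
  by have /cid[FX /cid[eta ?]] := univ X; exists FX, eta.
pose F X := projT1 (arrow X).
pose eta X : hom X (G (F X)) := sval (projT2 (arrow X)).
have etaP X : universal_arrow (eta X) := svalP (projT2 (arrow X)).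
pose ext X A (f : hom X (G A)) : hom (F X) A := sval (cid (etaP X A f)).
have extE X A (f : hom X (G A)) : fmap G (ext X A f) \c eta X = f.
  by rewrite /ext; case: (cid _) => g [].
have ext_inj X A (g h : hom (F X) A) :
    fmap G g \c eta X = fmap G h \c eta X -> g = h.
  move=> gh; have [k [_ ku]] := etaP X A (fmap G g \c eta X).
  by rewrite -(ku g) ?(ku h).
pose Fmap X Y (f : hom X Y) := ext X (F Y) (eta Y \c f).
have FmapE X Y (f : hom X Y) : fmap G (Fmap X Y f) \c eta X = eta Y \c f.
  exact: extE.
have Fmap1 X : Fmap X X (idm X) = idm (F X).
  by apply: ext_inj; rewrite FmapE fmap1 comp1m compm1.
have FmapM X Y Z (g : hom Y Z) (f : hom X Y) :
    Fmap X Z (g \c f) = Fmap Y Z g \c Fmap X Y f.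
  by apply: ext_inj; rewrite fmapM -compmA !FmapE !compmA FmapE.
pose FF : functor D C := Functor Fmap1 FmapM.
exists FF; constructor.
have unit_nat X Y (f : hom X Y) :
    fmap (G \F FF) f \c eta X = eta Y \c fmap (idfun_cat D) f.
  exact: FmapE.
pose eps A := ext (G A) A (idm (G A)).
have counit_nat A B (f : hom A B) :
    fmap (idfun_cat C) f \c eps A = eps B \c fmap (FF \F G) f.
  apply: ext_inj; rewrite !fmapM -!compmA /= extE.
  rewrite [X in _ = _ \c X]FmapE compmA extE.
  by rewrite [RHS](comp1m (fmap G f)); exact: (compm1 (fmap G f)).
pose unit := @Nattrans D D (idfun_cat D) (G \F FF) eta unit_nat.
pose counit := @Nattrans C C (FF \F G) (idfun_cat C) eps counit_nat.
apply: (@Adjunction _ _ _ _ unit counit) => /= [X|A]; last exact: extE.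
apply: ext_inj; rewrite fmapM fmap1 -compmA FmapE compmA extE.
by rewrite [LHS](comp1m (eta X)) [RHS]comp1m.
Qed.

End UniversalArrows.

(** * Fully faithful functors with a left adjoint *)

Section FullyFaithful.
Local Open Scope cat_scope.
Variables (C D : category) (G : functor C D).
Hypothesis Gfull :
  forall (A B : C) (g : hom (G A) (G B)), exists f : hom A B, fmap G f = g.
Hypothesis Gfaithful : forall (A B : C), injective (@fmap C D G A B).

Lemma fully_faithful_reflects_isomorphisms : reflects_isomorphisms G.
Proof.
move=> A B f [g']; have [g <-] := Gfull g' => -[gf fg].
by exists g; split; apply: Gfaithful; rewrite fmapM fmap1.
Qed.

Lemma fully_faithful_reflects_coequalizers (A B Q : C) (d0 d1 : hom A B)
    (q : hom B Q) :
  is_coequalizer (fmap G d0) (fmap G d1) (fmap G q) -> is_coequalizer d0 d1 q.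
Proof.
move=> [qd quniv]; split=> [|X f fd]; first by apply: Gfaithful; rewrite !fmapM.
have [|g' [g'q g'u]] := quniv (G X) (fmap G f); first by rewrite -!fmapM fd.
have [g gg'] := Gfull g'; exists g; split=> [|h hq].
  by apply: Gfaithful; rewrite fmapM gg'.
by apply: Gfaithful; rewrite gg'; apply: g'u; rewrite -fmapM hq.
Qed.

Lemma coequalizer_iso (A B Q P : C) (d0 d1 : hom A B)
    (q : hom B Q) (p : hom B P) :
  is_coequalizer d0 d1 q -> is_coequalizer d0 d1 p ->
  exists u : hom Q P, exists v : hom P Q,
    [/\ u \c q = p, v \c p = q, v \c u = idm Q & u \c v = idm P].
Proof.
move=> [qd qu] [pd pu].
have [u [uq _]] := qu P p pd; have [v [vp _]] := pu Q q qd.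
exists u, v; split=> //.
  have [w [_ wu]] := qu Q q qd.
  by rewrite -(wu (idm Q)) ?comp1m // -(wu (v \c u)) // -compmA uq.
have [w [_ wu]] := pu P p pd.
by rewrite -(wu (idm P)) ?comp1m // -(wu (u \c v)) // -compmA vp.
Qed.

(* As G is fully faithful, it is enough to find one object of C that is the
   coequalizer computed in D. *)
Lemma fully_faithful_CTT :
  has_left_adjoint G ->
  (forall (A B : C) (d0 d1 : hom A B), reflexive_pair d0 d1 ->
     exists (Q : C) (q : hom B Q),
       is_coequalizer (fmap G d0) (fmap G d1) (fmap G q)) ->
  CTT G.
Proof.
move=> Gadj Gcoeq; split=> //.
  exact: fully_faithful_reflects_isomorphisms.
move=> A B d0 d1 /Gcoeq[Q [q Gq]] _.
have q_coeq := fully_faithful_reflects_coequalizers Gq.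
split=> [|P p p_coeq]; first by exists Q, q.
(* Coequalizers are unique up to isomorphism, so the universal property of [fmap G q] is carried
   over to [fmap G p] along [fmap G u]. *)
have [u [v [up vq vu _]]] := coequalizer_iso p_coeq q_coeq.
case: Gq p_coeq => [_ Gq] [pd _]; split=> [|X f fd].
  by rewrite -!fmapM pd.
have [g [gq gu]] := Gq X f fd; exists (g \c fmap G u); split=> [|h hp].
  by rewrite -compmA -fmapM up.
rewrite -[h]compm1 -fmap1 -vu fmapM compmA (gu (h \c fmap G v)) //.
by rewrite -compmA -fmapM vq.
Qed.

(* The monad is idempotent: the counit is invertible, and so is the structure
   map of every algebra. *)
Lemma fully_faithful_monadic : has_left_adjoint G -> monadic G.
Proof.
move=> Gadj; split=> // F adj.
pose eta := adj_unit adj; pose eps := adj_counit adj.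
(* Fullness lifts the unit at [G A] to [s]. One composite is the identity by naturality of the
   counit and the first triangle identity, the other by the second triangle identity and
   faithfulness. *)
have counit_iso A : exists s : hom A (F (G A)),
    s \c eps A = idm (F (G A)) /\ eps A \c s = idm A.
  have [s sE] := Gfull (eta (G A)); exists s; split.
    rewrite -[LHS]/(fmap (idfun_cat C) s \c eps A) (ntE eps s) /= sE.
    exact: adj_triangleF.
  by apply: Gfaithful; rewrite fmapM sE fmap1; exact: adj_triangleG.
(* Both sides are left inverses of [fmap F (eta (em_ob X))], on the left by the unit law of the
   algebra and on the right by a triangle identity. That map is the inverse [s] of a counit, hence
   invertible, and its left inverse is unique. *)
have FactE (X : em_algebra (adj_monad adj)) :
    fmap F (em_act X) = eps (F (em_ob X)).
  have [s [se es]] := counit_iso (F (em_ob X)).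
  have Fs : fmap F (eta (em_ob X)) = s.
    rewrite -[LHS]comp1m -se -compmA.
    by have /= -> := adj_triangleF adj (em_ob X); rewrite compm1.
  have Fa : fmap F (em_act X) \c fmap F (eta (em_ob X)) = idm _.
    by rewrite -fmapM -fmap1 -(em_act_unit X).
  by rewrite -[LHS]compm1 -se compmA -Fs Fa comp1m.
(* Naturality of the unit at the structure map, combined with [FactE], reduces this to a triangle
   identity. Every structure map is therefore invertible, with the unit as inverse. *)
have act_unit (X : em_algebra (adj_monad adj)) :
    eta (em_ob X) \c em_act X = idm (G (F (em_ob X))).
  have /= := ntE eta (em_act X) => <-; rewrite FactE.
  exact: adj_triangleG.
pose U : functor (em_category (adj_monad adj)) D :=
  @Functor (em_category (adj_monad adj)) D (@em_ob _ _)
    (fun X Y f => sval f) (fun X => erefl) (fun X Y Z g f => erefl).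
(* The quasi-inverse applies F to the carrier of an algebra. The two natural isomorphisms are the
   counit and the family of structure maps. *)
exists (F \F U); split.
  pose a : nattrans ((F \F U) \F comparison adj) (idfun_cat C) :=
    @Nattrans _ _ ((F \F U) \F comparison adj) (idfun_cat C) (fun A => eps A)
      (fun A B f => ntE eps f).
  by exists a => A; have [s []] := counit_iso A; exists s.
have actP (X : em_algebra (adj_monad adj)) :
    em_act X \c em_act (comparison_ob adj (F (em_ob X))) =
    em_act X \c fmap (adj_monad adj) (em_act X).
  by rewrite (em_act_mul X).
have act_nat (X Y : em_category (adj_monad adj)) (f : hom X Y) :
    fmap (idfun_cat (em_category (adj_monad adj))) f \c
      (exist _ (em_act X) (actP X) :
         hom ((comparison adj \F (F \F U)) X) X) =
    (exist _ (em_act Y) (actP Y) :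
         hom ((comparison adj \F (F \F U)) Y) Y) \c
      fmap (comparison adj \F (F \F U)) f.
  by apply: em_hom_inj; exact: (svalP f).
exists (Nattrans act_nat) => X.
have unitP : eta (em_ob X) \c em_act X =
    em_act (comparison_ob adj (F (em_ob X))) \c
      fmap (adj_monad adj) (eta (em_ob X)).
  rewrite act_unit /= -fmapM -/eps.
  by have /= -> := adj_triangleF adj (em_ob X); rewrite fmap1.
exists (exist _ (eta (em_ob X)) unitP : hom X (comparison adj (F (em_ob X)))).
by split; apply: em_hom_inj; [exact: act_unit | exact: em_act_unit].
Qed.

End FullyFaithful.

(** * Quotients of C*-algebras *)

Definition modulus (R : realType) (c : R[i]) : R :=
  complex.Re (@Num.norm R[i] R[i] c).

(** Norms over [R[i]] take values in [R[i]]. Their real parts lie in [R], where infima, suprema and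
    linear arithmetic are available. *)
Definition rnorm (R : realType) (V : normedModType R[i]) (x : V) : R :=
  complex.Re `|x|.

Section RealNorm.
Variable R : realType.

Lemma rnormE (V : normedModType R[i]) (x : V) : `|x| = (rnorm x)%:C%C.
Proof.
rewrite /rnorm; have : 0 <= `|x| by [].
by case: `|x| => a b /=; rewrite lecE /= => /andP[/eqP-> _].
Qed.

Lemma modulusE (c : R[i]) : `|c| = (modulus c)%:C%C.
Proof.
rewrite /modulus; have : 0 <= `|c| by exact: normr_ge0.
by case: `|c| => a b /=; rewrite lecE /= => /andP[/eqP-> _].
Qed.

Lemma modulus_ge0 (c : R[i]) : 0 <= modulus c.
Proof. by rewrite -lecR -modulusE; exact: normr_ge0. Qed.

Lemma modulusM (c d : R[i]) : modulus (c * d) = modulus c * modulus d.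
Proof. by apply: complexI; rewrite rmorphM /= -!modulusE normrM. Qed.

Lemma modulus_real (r : R) : 0 <= r -> modulus r%:C%C = r.
Proof. by move=> r0; rewrite /modulus ger0_norm // lecR. Qed.

Lemma modulus0 : modulus (0 : R[i]) = 0.
Proof. exact: modulus_real. Qed.

Lemma modulus1 : modulus (1 : R[i]) = 1.
Proof. exact: modulus_real. Qed.

Lemma modulusN (c : R[i]) : modulus (- c) = modulus c.
Proof. by rewrite /modulus normrN. Qed.

Section NormedModule.
Variable V : normedModType R[i].
Implicit Types x y : V.

Lemma rnorm_ge0 x : 0 <= rnorm x.
Proof. by rewrite -lecR -rnormE; exact: normr_ge0. Qed.

Lemma rnormD x y : rnorm (x + y) <= rnorm x + rnorm y.
Proof. by rewrite -lecR rmorphD /= -!rnormE ler_normD. Qed.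

Lemma rnormN x : rnorm (- x) = rnorm x.
Proof. by rewrite /rnorm normrN. Qed.

Lemma rnormZ (c : R[i]) x : rnorm (c *: x) = modulus c * rnorm x.
Proof. by apply: complexI; rewrite rmorphM /= -modulusE -!rnormE normrZ. Qed.

Lemma rnormZr (r : R) x : 0 <= r -> rnorm (r%:C%C *: x) = r * rnorm x.
Proof. by move=> r0; rewrite rnormZ modulus_real. Qed.

Lemma rnormMn n x : rnorm (n%:R *: x) = n%:R * rnorm x.
Proof. by rewrite -rnormZr // rmorph_nat. Qed.

Lemma rnorm_eq0 x : rnorm x = 0 -> x = 0.
Proof. by move=> x0; apply/normr0_eq0; rewrite rnormE x0. Qed.

Lemma rnorm0 : rnorm (0 : V) = 0.
Proof. by rewrite /rnorm normr0. Qed.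

End NormedModule.

Section BanachStarAlgebra.
Variable B : banachStarAlgType R[i].
Implicit Types x y : B.

Lemma rnormM x y : rnorm (x ** y) <= rnorm x * rnorm y.
Proof. by rewrite -lecR rmorphM /= -!rnormE bnormM. Qed.

Lemma rnorm_star x : rnorm (star x) = rnorm x.
Proof. by rewrite /rnorm norm_star. Qed.

End BanachStarAlgebra.

Lemma rnorm_cstar (B : cstarAlgType R[i]) (x : B) :
  rnorm (star x ** x) = rnorm x ^+ 2.
Proof.
by apply: complexI; rewrite -rnormE cstar_identity rmorphXn /= -rnormE.
Qed.

Lemma contractiveE (A B : banachStarAlgType R[i]) (f : A -> B) :
  contractive f <-> forall x, rnorm (f x) <= rnorm x.
Proof. by split=> fc x; [rewrite -lecR -!rnormE|rewrite !rnormE lecR]. Qed.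

End RealNorm.

(** * C*-seminorms dominated by the norm *)

Section CstarSeminorms.
Variables (R : realType) (B : banachStarAlgType R[i]).
Implicit Types x y : B.

(** Homogeneity and the C*-identity are stated as inequalities, the form that infima and suprema
    deliver. The equalities are recovered in [snZ] and [sn_cstar]. *)
Record cstar_seminorm := CstarSeminorm {
  sn :> B -> R;
  snD : forall x y, sn (x + y) <= sn x + sn y;
  snZ_le : forall (c : R[i]) x, sn (c *: x) <= modulus c * sn x;
  snM : forall x y, sn (x ** y) <= sn x * sn y;
  sn_cstar_le : forall x, sn x ^+ 2 <= sn (star x ** x);
  sn_norm : forall x, sn x <= rnorm x
}.

Variable p : cstar_seminorm.

Lemma sn0 : p 0 = 0.
Proof.
have := snZ_le p 0 0; rewrite scale0r modulus0 mul0r => p0.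
have := snD p 0 0; rewrite addr0 => p00.
by apply/le_anti/andP; split=> //; lra.
Qed.

Lemma snN x : p (- x) = p x.
Proof.
have le y : p (- y) <= p y.
  by have := snZ_le p (- 1) y; rewrite modulusN modulus1 scaleN1r mul1r.
by apply/le_anti; rewrite le /= -{1}[x]opprK le.
Qed.

Lemma sn_ge0 x : 0 <= p x.
Proof. by have := snD p x (- x); rewrite snN subrr sn0; lra. Qed.

Lemma snZ (c : R[i]) x : p (c *: x) = modulus c * p x.
Proof.
apply/le_anti; rewrite snZ_le /=; have [->|c0] := eqVneq c 0.
  by rewrite modulus0 mul0r sn_ge0.
have cc : modulus c^-1 * modulus c = 1 by rewrite -modulusM mulVf // modulus1.
have := snZ_le p c^-1 (c *: x); rewrite scalerA mulVf // scale1r.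
move/(ler_wpM2l (modulus_ge0 c)); rewrite mulrA [modulus c * modulus _]mulrC cc.
by rewrite mul1r.
Qed.

(** From p(y)^2 <= p(star y ** y) <= p(star y) p(y), cancelling p(y) gives p(y) <= p(star y); the
    converse is the same inequality at [star y]. *)
Lemma sn_star x : p (star x) = p x.
Proof.
have le y : p y <= p (star y).
  have := le_trans (sn_cstar_le p y) (snM p _ _).
  have := sn_ge0 y; rewrite expr2 le_eqVlt => /orP[/eqP<-|y0].
    by rewrite sn_ge0.
  by rewrite ler_pM2r.
by apply/le_anti; rewrite le andbT -{2}[x]starK le.
Qed.

Lemma sn_cstar x : p (star x ** x) = p x ^+ 2.
Proof.
apply/le_anti; rewrite sn_cstar_le andbT.
by apply: le_trans (snM p _ _) _; rewrite sn_star.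
Qed.

Lemma sn_dist x y : `|p x - p y| <= p (x - y).
Proof.
rewrite ler_norml; apply/andP; split.
  have := snD p (- (x - y)) x; rewrite snN opprB subrK; lra.
by have := snD p (x - y) y; rewrite subrK; lra.
Qed.

End CstarSeminorms.

(** * The quotient seminorm of a star ideal *)

Section QuotientByIdeal.
Variables (R : realType) (B : cstarAlgType R[i]).
Implicit Types x y k j : B.

(* k + i y and k - i y are unitary; y and k y are the imaginary parts of k + i y
   and of half its square. *)
Lemma norm_im_unitary k y : star k = k -> star y = y -> k ** y = y ** k ->
  k ** k + y ** y = bone -> rnorm y <= 1 /\ rnorm (k ** y) <= 2^-1.
Proof.
move=> sk sy ky kkyy.
(* Here c stands for i or -i. As k and y commute, star (k + c y) ** (k + c y) = k^2 + y^2 = 1, and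
   the C*-identity bounds the norm. *)
have unit_le1 (c : R[i]) : Num.conj c = - c -> c * c = -1 ->
    rnorm (k + c *: y) <= 1.
  move=> cN cc; rewrite -(@expr_le1 _ 2) ?rnorm_ge0 // -rnorm_cstar starD starZ.
  rewrite sk sy cN bmulDl !bmulDr !bmulZl !bmulZr scalerA mulNr cc opprK.
  rewrite scale1r ky scaleNr addrA addrK kkyy.
  by rewrite -lecR -rnormE bnorm1.
have sq (c : R[i]) : c * c = -1 ->
    (k + c *: y) ** (k + c *: y) = (k ** k - y ** y) + (2 * c) *: (k ** y).
  move=> cc; rewrite bmulDl !bmulDr !bmulZl !bmulZr scalerA cc scaleN1r -ky.
  by rewrite [X in _ + X]addrC addrACA -scalerDl mulr_natl mulr2n.
have v1 := unit_le1 _ (@conjCi _) (etrans (esym (expr2 _)) (@sqrCi _)).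
have ii : (- 'i) * (- 'i) = -1 :> R[i] by rewrite mulrNN -expr2 sqrCi.
have w1 : rnorm (k + (- 'i) *: y) <= 1.
  by apply: unit_le1 => //; rewrite rmorphN /= conjCi.
set v := k + 'i *: y in v1; set w := k + (- 'i) *: y in w1.
have ni : modulus ('i : R[i]) = 1 by rewrite /modulus normCi.
split.
  have : rnorm (v - w) <= 2.
    by apply: le_trans (rnormD _ _) _; rewrite rnormN; lra.
  have -> : v - w = 2%:R *: ('i *: y).
    by rewrite /v /w opprD addrACA subrr add0r scaleNr opprK scaler_nat mulr2n.
  by rewrite rnormMn rnormZ ni; lra.
have : rnorm (v ** v - w ** w) <= 2.
  apply: le_trans (rnormD _ _) _; rewrite rnormN.
  have := rnormM v v; have := rnormM w w.
  by have := rnorm_ge0 v; have := rnorm_ge0 w; nra.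
have -> : v ** v - w ** w = 4%:R *: ('i *: (k ** y)).
  rewrite !sq // -?expr2 ?sqrCi // opprD addrACA subrr add0r -scalerBl.
  by rewrite mulrN opprK scalerA; congr (_ *: _); ring.
by rewrite rnormMn rnormZ ni; lra.
Qed.

Record star_ideal (J : set B) : Prop := StarIdeal {
  ideal0 : J 0;
  idealD : forall x y, J x -> J y -> J (x + y);
  idealZ : forall (c : R[i]) x, J x -> J (c *: x);
  idealMl : forall x y, J y -> J (x ** y);
  idealMr : forall x y, J x -> J (x ** y);
  idealS : forall x, J x -> J (star x)
}.

Variable J : set B.
Hypothesis idJ : star_ideal J.
Let J0 := ideal0 idJ.
Let JD := idealD idJ.
Let JZ := idealZ idJ.
Let JMl := idealMl idJ.
Let JMr := idealMr idJ.
Let JS := idealS idJ.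

(** Dividing j by c gives k of norm below 1, so that y = sqrt(1 - k^2) exists. With m = y^2 one has
    1 - m = k^2 in J and m k m = y (k y) y^2, of norm at most |k y| <= 1/2; scaling back gives
    c/2. *)
Lemma ideal_damp_half j (c : R) : J j -> star j = j -> rnorm j < c ->
  exists m, [/\ J (bone - m), rnorm m <= 1, star m = m &
    rnorm (m ** j ** m) <= c / 2].
Proof.
move=> Jj sj jc.
have c0 : 0 < c := le_lt_trans (rnorm_ge0 j) jc.
pose k := (c^-1)%:C%C *: j.
have sk : star k = k by rewrite /k starZ sj; congr (_ *: _); exact: conjc_real.
have k1 : rnorm k < 1.
  by rewrite /k rnormZr ?invr_ge0 ?(ltW c0) // ltr_pdivrMl // mulr1.
have kk1 : `|k ** k| < 1.
  rewrite rnormE -[1]/(1%:C)%C ltcR; apply: le_lt_trans (rnormM _ _) _.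
  by have := rnorm_ge0 k; nra.
have [|y [yy sy yc]] := sqrt_exists kk1; first by rewrite starM sk.
have ky : k ** y = y ** k by apply: yc; rewrite bmulA.
have [|y1 ky2] := norm_im_unitary sk sy ky; first by rewrite yy addrC subrK.
exists (y ** y); split.
- by rewrite yy opprB addrC subrK; exact/JMl/JZ.
- apply: le_trans (rnormM _ _) _; have := rnorm_ge0 y; nra.
- by rewrite starM sy.
have -> : j = c%:C%C *: k.
  by rewrite /k scalerA -rmorphM /= mulfV ?scale1r // gt_eqF.
rewrite bmulZr bmulZl rnormZr ?(ltW c0) // ler_pM2l //.
have -> : (y ** y) ** k ** (y ** y) = (y ** (k ** y)) ** (y ** y).
  by rewrite ky !bmulA.
apply: le_trans (rnormM _ _) _; apply: le_trans (_ : rnorm (k ** y) * 1 <= _).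
  apply: ler_pM; rewrite ?rnorm_ge0 //.
    apply: le_trans (rnormM _ _) _; have := rnorm_ge0 (k ** y); nra.
  apply: le_trans (rnormM _ _) _; have := rnorm_ge0 y; nra.
by rewrite mulr1.
Qed.

Lemma ideal_damp j (e : R) : J j -> star j = j -> 0 < e ->
  exists m, [/\ J (bone - m), rnorm m <= 1 & rnorm (star m ** j ** m) < e].
Proof.
move=> Jj sj e0.
(* Halving turns a strict bound c into a weak bound c/2; the ratio 2/3 makes the bound strict again
   for the next round. The summand 1 makes the initial bound strict. The halving is applied to
   [star m ** j ** m], which is again self-adjoint and in J. *)
have damp n : exists m, [/\ J (bone - m), rnorm m <= 1 &
    rnorm (star m ** j ** m) < (2 / 3) ^+ n * (rnorm j + 1)].
  elim: n => [|n [m [Jm m1 mj]]].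
    exists bone; split.
    - by rewrite subrr -(scale0r j); exact: JZ.
    - by rewrite -lecR -rnormE bnorm1.
    - by rewrite star1 bmul1x bmulx1 expr0 mul1r; lra.
  have [||m' [Jm' m'1 sm' m'j]] := ideal_damp_half _ _ mj.
  - exact/JMr/JMl.
  - by rewrite !starM starK sj bmulA.
  exists (m ** m'); split.
  - rewrite (_ : _ - _ = (bone - m) + m ** (bone - m')).
      exact/JD/JMl.
    by rewrite bmulDr bmulx1 bmulxN addrA subrK.
  - apply: le_trans (rnormM _ _) _.
    by have := rnorm_ge0 m; have := rnorm_ge0 m'; nra.
  - have -> : star (m ** m') ** j ** (m ** m') =
        m' ** (star m ** j ** m) ** m'.
      by rewrite starM sm' !bmulA.
    apply: le_lt_trans m'j _; rewrite exprS.
    have : 0 < (2 / 3) ^+ n * (rnorm j + 1).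
      by rewrite mulr_gt0 ?exprn_gt0 //; have := rnorm_ge0 j; lra.
    by move: (_ ^+ n) => t; lra.
have j1 : 0 < rnorm j + 1 by have := rnorm_ge0 j; lra.
have [|||n ne] := @expr_small R (2 / 3)%:C%C (e / (rnorm j + 1))%:C%C.
- by rewrite -[leLHS]/(0%:C%C) lecR; lra.
- by rewrite -[ltRHS]/(1%:C%C) ltcR; lra.
- by rewrite -[ltLHS]/(0%:C%C) ltcR divr_gt0.
move: ne; rewrite -rmorphXn /= ltcR ltr_pdivlMr // => ne.
by have [m [? ? mj]] := damp n; exists m; split=> //; exact: lt_trans mj ne.
Qed.


Let coset_norms x : set R := [set r | exists2 j, J j & r = rnorm (x + j)].
Let qnorm x : R := inf (coset_norms x).

Let qnorm_le x j : J j -> qnorm x <= rnorm (x + j).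
Proof.
move=> Jj; apply: ge_inf; last by exists j.
by exists 0 => _ [k _ ->]; exact: rnorm_ge0.
Qed.

Let qnorm_lt x (c : R) : qnorm x < c -> exists2 j, J j & rnorm (x + j) < c.
Proof.
move=> /inf_lt[|_ [j Jj ->]]; last by exists j.
by exists (rnorm (x + 0)); exists 0.
Qed.

Let qnorm_ge0 x : 0 <= qnorm x.
Proof.
apply: lb_le_inf => [|_ [j _ ->]]; last exact: rnorm_ge0.
by exists (rnorm (x + 0)); exists 0.
Qed.

Let le_of_lt (a b : R) : (forall c, b < c -> a <= c) -> a <= b.
Proof.
by move=> abc; apply/ler_addgt0Pr => e e0; apply: abc; rewrite ltrDl.
Qed.

Let qnormD x y : qnorm (x + y) <= qnorm x + qnorm y.
Proof.
rewrite -lerBlDr; apply: le_of_lt => c /qnorm_lt[j Jj jc].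
rewrite lerBlDl -lerBlDr; apply: le_of_lt => d /qnorm_lt[k Jk kd].
rewrite lerBlDr; apply: le_trans (qnorm_le (x + y) (JD Jj Jk)) _.
by rewrite addrACA; apply: le_trans (rnormD _ _) _; lra.
Qed.

Let qnormZ (c : R[i]) x : qnorm (c *: x) <= modulus c * qnorm x.
Proof.
have := modulus_ge0 c; rewrite le_eqVlt => /orP[/eqP c0|c0].
  apply: le_trans (qnorm_le _ J0) _.
  by rewrite addr0 rnormZ -c0 !mul0r.
rewrite -ler_pdivrMl //; apply: le_of_lt => d /qnorm_lt[j Jj jd].
rewrite ler_pdivrMl //; apply: le_trans (qnorm_le _ (JZ c Jj)) _.
by rewrite -scalerDr rnormZ ler_pM2l // ltW.
Qed.

Let qnormM x y : qnorm (x ** y) <= qnorm x * qnorm y.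
Proof.
have step j k : J j -> J k -> qnorm (x ** y) <= rnorm (x + j) * rnorm (y + k).
  move=> Jj Jk; apply: le_trans (rnormM _ _).
  rewrite bmulDl bmulDr -addrA; apply: qnorm_le.
  by apply: JD; [exact: JMl|exact: JMr].
(* The infimum is taken over one factor at a time. This divides by the other factor; when that one
   is 0, a single representative gives the bound. *)
have stepl j : J j -> qnorm (x ** y) <= rnorm (x + j) * qnorm y.
  move=> Jj; have := rnorm_ge0 (x + j); rewrite le_eqVlt => /orP[/eqP r0|r0].
    by have := step j 0 Jj J0; rewrite -r0 !mul0r.
  rewrite -ler_pdivrMl //; apply: le_of_lt => d /qnorm_lt[k Jk kd].
  rewrite ler_pdivrMl //; apply: le_trans (step j k Jj Jk) _.
  by rewrite ler_pM2l // ltW.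
have := qnorm_ge0 y; rewrite le_eqVlt => /orP[/eqP y0|y0].
  by have := stepl 0 J0; rewrite -y0 !mulr0.
rewrite -ler_pdivrMr //; apply: le_of_lt => d /qnorm_lt[j Jj jd].
rewrite ler_pdivrMr //; apply: le_trans (stepl j Jj) _.
by rewrite ler_pM2r // ltW.
Qed.

Let qnorm_cstar x : qnorm x ^+ 2 <= qnorm (star x ** x).
Proof.
apply: le_of_lt => c /qnorm_lt[k Jk kc].
(* Since [star x ** x] is self-adjoint, replacing k by its self-adjoint part replaces
   [star x ** x + k] by its own self-adjoint part, whose norm is no larger. *)
pose j := 2^-1 *: (k + star k).
have Jj : J j by exact/JZ/JD/JS.
have sj : star j = j.
  rewrite /j starZ starD starK fmorphV /= rmorph_nat.
  by rewrite [star k + k]addrC.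
have jc : rnorm (star x ** x + j) <= c.
  have -> : star x ** x + j =
      (2^-1)%:C%C *: ((star x ** x + k) + star (star x ** x + k)).
    rewrite starD starM starK addrACA scalerDr fmorphV /= rmorph_nat.
    have -> : star x ** x + star x ** x = 2%:R *: (star x ** x).
      by rewrite scaler_nat mulr2n.
    by rewrite scalerA mulVf ?scale1r // pnatr_eq0.
  rewrite rnormZr ?invr_ge0 //; rewrite ler_pdivrMl //.
  by apply: le_trans (rnormD _ _) _; rewrite rnorm_star; lra.
apply/ler_addgt0Pr => e e0.
have [m [Jm m1 me]] := ideal_damp Jj sj e0.
(* As 1 - m lies in J, [x ** m] belongs to the coset of x. *)
have xm : qnorm x <= rnorm (x ** m).
  have -> : x ** m = x + (- 1) *: (x ** (bone - m)).
    by rewrite bmulDr bmulx1 bmulxN scaleN1r opprB addrC subrK.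
  exact/qnorm_le/JZ/JMl.
apply: le_trans (_ : rnorm (x ** m) ^+ 2 <= _).
  by rewrite ler_sqr ?nnegrE ?rnorm_ge0 // qnorm_ge0.
rewrite -rnorm_cstar starM.
have -> : star m ** star x ** (x ** m) =
    star m ** (star x ** x + j) ** m - star m ** j ** m.
  by rewrite bmulDr bmulDl addrK !bmulA.
apply: le_trans (rnormD _ _) _; rewrite rnormN; apply: lerD; last exact: ltW.
apply: le_trans (rnormM _ _) _; apply: le_trans _ jc.
apply: le_trans (_ : rnorm (star m ** (star x ** x + j)) * 1 <= _).
  by rewrite ler_wpM2l ?rnorm_ge0.
rewrite mulr1; apply: le_trans (rnormM _ _) _.
by rewrite rnorm_star ler_piMl ?rnorm_ge0.
Qed.

Let qnorm_norm x : qnorm x <= rnorm x.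
Proof. by rewrite -[leRHS](congr1 _ (addr0 x)); exact: qnorm_le. Qed.

Definition ideal_seminorm : cstar_seminorm B :=
  CstarSeminorm qnormD qnormZ qnormM qnorm_cstar qnorm_norm.

(** This is the form in which a contraction vanishing on J is shown to be bounded by the quotient
    seminorm. *)
Lemma ideal_seminormP x (c : R) :
  (forall j, J j -> c <= rnorm (x + j)) -> c <= ideal_seminorm x.
Proof.
move=> cx; apply: lb_le_inf => [|_ [j Jj ->]]; last exact: cx.
by exists (rnorm (x + 0)); exists 0.
Qed.

Lemma ideal_seminorm_eq0 x : J x -> ideal_seminorm x = 0.
Proof.
move=> Jx; apply/le_anti; rewrite sn_ge0 andbT.
have := qnorm_le x (JZ (-1) Jx).
by rewrite scaleN1r subrr rnorm0.
Qed.

End QuotientByIdeal.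

(** * The largest C*-seminorm dominated by the norm *)

Section LargestSeminorm.
Variables (R : realType) (B : banachStarAlgType R[i]).
Implicit Types (x y : B) (q : cstar_seminorm B).

Let values x : set R := [set r | exists q, r = q x].
Let mx x : R := sup (values x).

(** It makes each set [values x] nonempty, so that the suprema are genuine. *)
Definition zero_seminorm : cstar_seminorm B.
Proof.
by apply: (@CstarSeminorm R B (fun=> 0)) => *;
  rewrite ?addr0 ?mulr0 ?expr0n ?rnorm_ge0.
Defined.

Let values0 x : (values x !=set0)%classic.
Proof. by exists (zero_seminorm x); exists zero_seminorm. Qed.

Let le_mx q x : q x <= mx x.
Proof.
by apply: ub_le_sup; [exists (rnorm x) => _ [r ->]; exact: sn_norm|exists q].
Qed.

Let mx_le x (c : R) : (forall q, q x <= c) -> mx x <= c.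
Proof. by move=> qc; apply: ge_sup => // _ [q ->]; exact: qc. Qed.

Let mx_ge0 x : 0 <= mx x.
Proof. exact: le_trans (sn_ge0 zero_seminorm x) (le_mx _ _). Qed.

Let mxD x y : mx (x + y) <= mx x + mx y.
Proof.
by apply: mx_le => q; apply: le_trans (snD q x y) _; apply: lerD; exact: le_mx.
Qed.

Let mxZ (c : R[i]) x : mx (c *: x) <= modulus c * mx x.
Proof.
by apply: mx_le => q; rewrite snZ ler_wpM2l ?modulus_ge0 ?le_mx.
Qed.

Let mxM x y : mx (x ** y) <= mx x * mx y.
Proof.
apply: mx_le => q; apply: le_trans (snM q x y) _.
by apply: ler_pM; rewrite ?sn_ge0 ?le_mx.
Qed.

Let mx_cstar x : mx x ^+ 2 <= mx (star x ** x).
Proof.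
have m0 := mx_ge0 (star x ** x).
(* Taking square roots removes the square from the supremum, which can then be bounded one seminorm
   at a time. *)
rewrite -(sqr_sqrtr m0) ler_sqr ?nnegrE ?mx_ge0 ?sqrtr_ge0 //.
apply: mx_le => q; rewrite -(@ler_sqr _ (q x)) ?nnegrE ?sn_ge0 ?sqrtr_ge0 //.
by rewrite sqr_sqrtr // -sn_cstar le_mx.
Qed.

Let mx_norm x : mx x <= rnorm x.
Proof. by apply: mx_le => q; exact: sn_norm. Qed.

Definition largest_seminorm : cstar_seminorm B :=
  CstarSeminorm mxD mxZ mxM mx_cstar mx_norm.

Lemma largest_seminorm_ge q x : q x <= largest_seminorm x.
Proof. exact: le_mx. Qed.

End LargestSeminorm.

(** * Completion of a C*-seminorm *)

Section CauchySequences.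
Local Open Scope classical_set_scope.
Local Open Scope quotient_scope.
Variables (R : realType) (B : banachStarAlgType R[i]) (p : cstar_seminorm B).
Implicit Types s t : nat -> B.

(** In this nested form the threshold for m may depend on n. By the triangle inequality it is
    equivalent to the usual condition, and it suits [near] reasoning. *)
Definition sn_cauchy s : Prop := forall e : R, 0 < e ->
  \forall n \near \oo, \forall m \near \oo, p (s m - s n) <= e.

Definition sn_null s : Prop := forall e : R, 0 < e ->
  \forall n \near \oo, p (s n) <= e.

Lemma sn_nullD s t : sn_null s -> sn_null t -> sn_null (s + t).
Proof.
move=> s0 t0 e e0; have e2 : 0 < e / 2 by lra.
near=> n; apply: le_trans (snD p _ _) _.
have : p (s n) <= e / 2 by near: n; exact: s0.
have : p (t n) <= e / 2 by near: n; exact: t0.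
lra.
Unshelve. all: by end_near. Qed.

Lemma sn_nullN s : sn_null s -> sn_null (- s).
Proof.
by move=> s0 e /s0; apply: filterS => n; rewrite -[p (s n)]snN.
Qed.

Lemma sn_cauchyD s t : sn_cauchy s -> sn_cauchy t -> sn_cauchy (s + t).
Proof.
move=> cs ct e e0; have e2 : 0 < e / 2 by lra.
near=> n; near=> m.
rewrite [X in p X](_ : _ = (s m - s n) + (t m - t n)); last first.
  by rewrite addrACA -opprD.
apply: le_trans (snD p _ _) _.
have : p (s m - s n) <= e / 2 by near: m; near: n; exact: cs.
have : p (t m - t n) <= e / 2 by near: m; near: n; exact: ct.
lra.
Unshelve. all: by end_near. Qed.

Lemma sn_cauchyZ (c : R[i]) s : sn_cauchy s -> sn_cauchy (c *: s).
Proof.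
move=> cs e e0; have c0 := modulus_ge0 c.
have d0 : 0 < e / (modulus c + 1) by rewrite divr_gt0 //; lra.
near=> n; near=> m.
have -> : (c *: s) m - (c *: s) n = c *: (s m - s n) by rewrite scalerBr.
rewrite snZ; have : p (s m - s n) <= e / (modulus c + 1).
  by near: m; near: n; exact: cs.
rewrite ler_pdivlMr; last by lra.
by have := sn_ge0 p (s m - s n); nra.
Unshelve. all: by end_near. Qed.

Lemma sn_cauchy_cst (x : B) : sn_cauchy (fun=> x).
Proof.
by move=> e e0; near=> n; near=> m; rewrite subrr sn0 ltW.
Unshelve. all: by end_near. Qed.

Lemma sn_cauchy_bounded s : sn_cauchy s ->
  exists2 M : R, 0 < M & \forall n \near \oo, p (s n) <= M.
Proof.
move=> /(_ 1 ltr01) cs; near \oo => n.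
have sn : \forall m \near \oo, p (s m - s n) <= 1 by near: n.
exists (1 + p (s n)); first by have := sn_ge0 p (s n); lra.
apply: filterS sn => m sm.
by have := snD p (s m - s n) (s n); rewrite subrK; lra.
Unshelve. all: by end_near. Qed.

Lemma sn_cauchyM s t : sn_cauchy s -> sn_cauchy t ->
  sn_cauchy (fun n => s n ** t n).
Proof.
move=> cs ct e e0.
have [M M0 sM] := sn_cauchy_bounded cs; have [K K0 tK] := sn_cauchy_bounded ct.
have e1 : 0 < e / (M + K) by rewrite divr_gt0 // addr_gt0.
near=> n; near=> m.
have -> : s m ** t m - s n ** t n = s m ** (t m - t n) + (s m - s n) ** t n.
  by rewrite bmulDr bmulDl bmulxN bmulNx addrA subrK.
apply: le_trans (snD p _ _) _.
have tmn : p (t m - t n) <= e / (M + K) by near: m; near: n; exact: ct.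
have smn : p (s m - s n) <= e / (M + K) by near: m; near: n; exact: cs.
have sm : p (s m) <= M by near: m.
have tn : p (t n) <= K by near: n.
rewrite (_ : e = M * (e / (M + K)) + (e / (M + K)) * K); last first.
  by rewrite [_ * K]mulrC -mulrDl mulrCA divff ?mulr1 // gt_eqF // addr_gt0.
by apply: lerD; apply: le_trans (snM p _ _) _; apply: ler_pM; rewrite ?sn_ge0.
Unshelve. all: by end_near. Qed.

Lemma sn_cauchy_star s : sn_cauchy s -> sn_cauchy (fun n => star (s n)).
Proof.
move=> cs e e0; near=> n; near=> m.
by rewrite -starN -starD sn_star; near: m; near: n; exact: cs.
Unshelve. all: by end_near. Qed.

Lemma sn_nullMl s t : sn_cauchy s -> sn_null t -> sn_null (fun n => s n ** t n).
Proof.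
move=> cs t0 e e0; have [M M0 sM] := sn_cauchy_bounded cs.
have e1 : 0 < e / M by rewrite divr_gt0.
near=> n; apply: le_trans (snM p _ _) _.
have sn : p (s n) <= M by near: n.
have : p (t n) <= e / M by near: n; exact: t0.
rewrite ler_pdivlMr //; apply: le_trans.
by rewrite mulrC ler_wpM2l ?sn_ge0.
Unshelve. all: by end_near. Qed.

Lemma sn_nullMr s t : sn_cauchy s -> sn_null t -> sn_null (fun n => t n ** s n).
Proof.
move=> cs t0 e e0; have [M M0 sM] := sn_cauchy_bounded cs.
have e1 : 0 < e / M by rewrite divr_gt0.
near=> n; apply: le_trans (snM p _ _) _.
have sn : p (s n) <= M by near: n.
have : p (t n) <= e / M by near: n; exact: t0.
rewrite ler_pdivlMr //; apply: le_trans.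
by rewrite ler_wpM2l ?sn_ge0.
Unshelve. all: by end_near. Qed.

Lemma sn_cvg s : sn_cauchy s -> cvgn (fun n => p (s n)).
Proof.
move=> cs; apply/cauchy_cvgP/cauchy_exP => e e0; have e2 : 0 < e / 2 by lra.
near \oo => n; exists (p (s n)).
have : \forall m \near \oo, p (s m - s n) <= e / 2 by near: n; exact: cs.
apply: filterS => m sm; rewrite -ball_normE /= distrC.
by apply: le_lt_trans (sn_dist p _ _) _; lra.
Unshelve. all: by end_near. Qed.

Lemma sn_nullP s : sn_null s <-> (fun n => p (s n)) @ \oo --> (0 : R).
Proof.
split=> [s0|/cvgrPdist_le s0 e /s0]; last first.
  by apply: filterS => n; rewrite sub0r normrN ger0_norm // sn_ge0.
apply/cvgrPdist_le => e /s0; apply: filterS => n.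
by rewrite sub0r normrN ger0_norm // sn_ge0.
Qed.

Definition cauchy_seq_pred : pred (nat -> B) := fun s => `[< sn_cauchy s >].

Lemma cauchy_seq_submod : submod_closed cauchy_seq_pred.
Proof.
split=> [|c s t /asboolP cs /asboolP ct]; apply/asboolP.
  exact: sn_cauchy_cst.
exact/sn_cauchyD/ct/sn_cauchyZ.
Qed.

HB.instance Definition _ :=
  GRing.isSubmodClosed.Build R[i] (nat -> B) cauchy_seq_pred cauchy_seq_submod.

Record cauchy_seq :=
  CauchySeq { cseq :> nat -> B; cseqP : cauchy_seq_pred cseq }.

HB.instance Definition _ := [isSub for cseq].
HB.instance Definition _ := [Choice of cauchy_seq by <:].
HB.instance Definition _ := [SubChoice_isSubLmodule of cauchy_seq by <:].

Definition null_seq_pred : {pred cauchy_seq} := fun u => `[< sn_null u >].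

Lemma null_seq_zmod : zmod_closed null_seq_pred.
Proof.
split=> [|s t /asboolP s0 /asboolP t0]; apply/asboolP.
  by move=> e e0; near=> n; rewrite sn0 ltW.
exact: (sn_nullD s0 (sn_nullN t0)).
Unshelve. all: by end_near. Qed.

HB.instance Definition _ :=
  GRing.isZmodClosed.Build cauchy_seq null_seq_pred null_seq_zmod.

(** The quotient is taken as an additive group. Scalars, product, star and norm are defined
    afterwards on chosen representatives and shown not to depend on the choice. *)
Definition completion := @Quotient.quot cauchy_seq null_seq_pred.
HB.instance Definition _ := GRing.Zmodule.on completion.


Definition to_completion (u : cauchy_seq) : completion := \pi_completion u.

Lemma completionW (P : completion -> Prop) :
  (forall u, P (to_completion u)) -> forall x, P x.
Proof. by move=> Pu; elim/quotW. Qed.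

Lemma to_completionP (u v : cauchy_seq) :
  to_completion u = to_completion v <-> sn_null (cseq u - cseq v).
Proof.
split=> [/eqP|uv]; first by rewrite -Quotient.idealrBE => /asboolP.
by apply/eqP; rewrite -Quotient.idealrBE; apply/asboolP.
Qed.

Lemma to_completionD : {morph to_completion : u v / u + v}.
Proof. by move=> u v; rewrite /to_completion !piE. Qed.

End CauchySequences.

Lemma complex_gt0E (R : realType) (e : R[i]) : 0 < e ->
  exists2 r : R, 0 < r & e = r%:C%C.
Proof.
by case: e => a b; rewrite ltcE /= => /andP[/eqP-> a0]; exists a.
Qed.

(** * The C*-algebra structure of the completion *)

Section CompletionStructure.
Local Open Scope classical_set_scope.
Local Open Scope quotient_scope.
Variables (R : realType) (B : banachStarAlgType R[i]) (p : cstar_seminorm B).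
Local Notation E := (completion p).
Local Notation pi := (@to_completion R B p).
Implicit Types (u v w : cauchy_seq p) (x y z : E).

Let rep x : cauchy_seq p := repr x.

Let rep_null u : sn_null p (cseq (rep (pi u)) - cseq u).
Proof. by apply/to_completionP; exact: reprK. Qed.

Let cseq_cauchy u : sn_cauchy p u.
Proof. by apply/asboolP; exact: cseqP. Qed.

Let mk (s : nat -> B) (cs : sn_cauchy p s) : cauchy_seq p :=
  CauchySeq (asboolT cs).

Definition completion_inj (b : B) : E := pi (mk (sn_cauchy_cst p b)).

Definition completion_scale (c : R[i]) x : E := pi (c *: rep x).
Definition completion_mul x y : E :=
  pi (mk (sn_cauchyM (cseq_cauchy (rep x)) (cseq_cauchy (rep y)))).
Definition completion_star x : E :=
  pi (mk (sn_cauchy_star (cseq_cauchy (rep x)))).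
Definition completion_norm x : R := lim ((fun n => p (rep x n)) @ \oo).

Let scaleE c u : completion_scale c (pi u) = pi (c *: u).
Proof.
apply/to_completionP => /= e e0.
have d0 : 0 < e / (modulus c + 1).
  by rewrite divr_gt0 //; have := modulus_ge0 c; lra.
have := rep_null u d0; apply: filterS => n.
rewrite ler_pdivlMr; last by have := modulus_ge0 c; lra.
apply: le_trans; rewrite -[X in p X]/(c *: rep (pi u) n - c *: u n).
by rewrite -scalerBr snZ mulrC ler_wpM2l ?sn_ge0 // lerDl.
Qed.

Let mulE u v :
  completion_mul (pi u) (pi v) =
  pi (mk (sn_cauchyM (cseq_cauchy u) (cseq_cauchy v))).
Proof.
apply/to_completionP => /=.
(* With u', v' the chosen representatives, u' v' - u v = (u' - u) v' + u (v' - v), and a null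
   sequence times a Cauchy sequence is null. *)
have := sn_nullD (sn_nullMr (cseq_cauchy (rep (pi v))) (rep_null u))
  (sn_nullMl (cseq_cauchy u) (rep_null v)).
congr sn_null; apply/funext => n; rewrite !fctE.
by rewrite bmulDl bmulDr bmulxN bmulNx addrA subrK.
Qed.

Let starE u : completion_star (pi u) = pi (mk (sn_cauchy_star (cseq_cauchy u))).
Proof.
apply/to_completionP => /= e /(rep_null u); apply: filterS => n.
by rewrite !fctE -starN -starD sn_star.
Qed.

(** The chosen representative differs from u by a null sequence, so both have the same limit of
    seminorms. Inequalities and identities for p thus pass to the norm along arbitrary
    representatives. *)
Let norm_cvg u : p (u n) @[n --> \oo] --> completion_norm (pi u).
Proof.
have := sn_cvg (cseq_cauchy (rep (pi u))).
rewrite -/(completion_norm (pi u)) => /cvgrPdist_le rc.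
apply/cvgrPdist_le => e e0; have e2 : 0 < e / 2 by lra.
near=> n.
have h1 : `|completion_norm (pi u) - p (rep (pi u) n)| <= e / 2.
  by near: n; exact: rc.
have h2 : p (rep (pi u) n - u n) <= e / 2 by near: n; exact: rep_null.
have := le_trans (sn_dist p _ _) h2.
move: h1; rewrite !ler_norml => /andP[? ?] /andP[? ?]; apply/andP; lra.
Unshelve. all: by end_near. Qed.

Arguments norm_cvg : clear implicits.

(** Reduces the algebraic laws of the completion to the corresponding laws in B, term by term. *)
Let pi_ext u v : (forall n, u n = v n) -> pi u = pi v.
Proof.
move=> uv; apply/to_completionP => e e0; near=> n.
by rewrite !fctE uv subrr sn0 ltW.
Unshelve. all: by end_near. Qed.

Let scaleA (c d : R[i]) x :
  completion_scale c (completion_scale d x) = completion_scale (c * d) x.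
Proof. by elim/completionW: x => u; rewrite !scaleE scalerA. Qed.

Let scale1 : left_id 1 completion_scale.
Proof. by elim/completionW => u; rewrite scaleE scale1r. Qed.

Let scaleDr : right_distributive completion_scale +%R.
Proof.
move=> c x y; elim/completionW: x => u; elim/completionW: y => v.
by rewrite -to_completionD !scaleE scalerDr to_completionD.
Qed.

Let scaleDl x : {morph completion_scale^~ x : c d / c + d}.
Proof.
move=> c d; elim/completionW: x => u.
by rewrite !scaleE scalerDl to_completionD.
Qed.

HB.instance Definition _ :=
  GRing.Zmodule_isLmodule.Build R[i] E scaleA scale1 scaleDr scaleDl.

Let normD x y : (completion_norm (x + y))%:C%C <=
  (completion_norm x)%:C%C + (completion_norm y)%:C%C.
Proof.
elim/completionW: x => u; elim/completionW: y => v.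
rewrite -rmorphD /= lecR -to_completionD.
have uv : p (u n) + p (v n) @[n --> \oo] -->
    completion_norm (pi u) + completion_norm (pi v).
  by apply: cvgD; exact: norm_cvg.
apply: ler_cvg_to (norm_cvg (u + v)) uv _.
by near=> n; exact: snD.
Unshelve. all: by end_near. Qed.

Let normZ (c : R[i]) x :
  (completion_norm (c *: x))%:C%C = `|c| * (completion_norm x)%:C%C.
Proof.
elim/completionW: x => u; rewrite [c *: _]scaleE modulusE -rmorphM /=.
congr (_%:C%C); apply: (cvg_unique _ (norm_cvg (c *: u))) => //.
have -> : (fun n => p ((c *: u : cauchy_seq p) n)) =
    fun n => modulus c * p (u n).
  by apply/funext => n; rewrite -snZ.
exact: cvgM (cvg_cst _) (norm_cvg u).
Qed.

Let norm0_eq0 x : (completion_norm x)%:C%C = 0 :> R[i] -> x = 0.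
Proof.
elim/completionW: x => u u0; have {}u0 : completion_norm (pi u) = 0.
  by apply: complexI.
rewrite -[RHS](_ : pi 0 = 0); last by rewrite /to_completion !piE.
apply/to_completionP; rewrite subr0; apply/sn_nullP.
by have := norm_cvg u; rewrite u0.
Qed.

HB.instance Definition _ :=
  Lmodule_isNormed.Build R[i] E normD normZ norm0_eq0.

Lemma completion_rnorm_cvg u : p (u n) @[n --> \oo] --> rnorm (pi u).
Proof. exact: norm_cvg. Qed.
Arguments completion_rnorm_cvg : clear implicits.

Lemma completion_inj_norm b : rnorm (completion_inj b) = p b.
Proof.
have cb : (fun=> p b) @ \oo --> p b by exact: cvg_cst.
by apply: (cvg_unique _ (completion_rnorm_cvg (mk (sn_cauchy_cst p b))) cb).
Qed.

Lemma completion_piB u v : pi u - pi v = pi (u - v).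
Proof. by rewrite /to_completion !piE. Qed.

Lemma completion_injD : {morph completion_inj : b c / b + c}.
Proof. by move=> b c; rewrite -to_completionD; exact: pi_ext. Qed.

Lemma completion_injN : {morph completion_inj : b / - b}.
Proof.
move=> b; have -> : - completion_inj b = pi (- mk (sn_cauchy_cst p b)).
  by rewrite /completion_inj /to_completion !piE.
exact: pi_ext.
Qed.

(** For a fixed large n, the bound p (u m - u n) <= e holds for all large m and passes to the limit
    in m. *)
Lemma completion_near_inj u (e : R) : 0 < e ->
  \forall n \near \oo, rnorm (pi u - completion_inj (u n)) <= e.
Proof.
move=> /(cseq_cauchy u); apply: filterS => n un.
rewrite completion_piB.
exact: (cvgr_to_le (completion_rnorm_cvg (u - mk (sn_cauchy_cst p (u n)))) un).
Qed.

Lemma completion_dense x (e : R) : 0 < e ->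
  exists b, rnorm (x - completion_inj b) <= e.
Proof.
elim/completionW: x => u e0; near \oo => n; exists (u n).
by near: n; exact: completion_near_inj.
Unshelve. all: by end_near. Qed.

(** For each n some point [s n] of B has an image around which a ball of radius [2 * h n] belongs to
    F. Any two such balls meet, so s is Cauchy for p, and its class is the limit of F. *)
Lemma completion_complete (F : set_system E) :
  ProperFilter F -> cauchy F -> cvg F.
Proof.
move=> FF /cauchyP Fc.
have [h h0 h_small] : exists2 h : nat -> R, (forall n, 0 < h n) &
    forall e, 0 < e -> \forall n \near \oo, h n <= e.
  exists (fun n => n.+1%:R^-1) => [n|e e0]; first by rewrite invr_gt0.
  have := near_infty_natSinv_lt (interval_inference.PosNum e0).
  by apply: filterS => n; exact: ltW.
(* One [h n] is the radius of a ball belonging to F, the other the error in approximating its centre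
   from B. *)
have approx n : {b | F [set x | rnorm (x - completion_inj b) <= 2 * h n]}.
  apply: cid; have [|x Fx] := Fc (h n)%:C%C.
    by rewrite -[ltLHS]/(0%:C%C) ltcR.
  have [b xb] := completion_dense x (h0 n); exists b.
  apply: filterS Fx => y; rewrite -ball_normE /= distrC rnormE ltcR => yx.
  have -> : y - completion_inj b = (y - x) + (x - completion_inj b).
    by rewrite addrA subrK.
  apply: le_trans (rnormD _ _) _.
  by rewrite mulr_natl mulr2n; apply: lerD => //; exact: ltW.
pose s n := sval (approx n).
have sP n : F [set x | rnorm (x - completion_inj (s n)) <= 2 * h n].
  exact: svalP (approx n).
have s_dist m n : p (s m - s n) <= 2 * h m + 2 * h n.
  have [x [xm xn]] := filter_ex (filterI (sP m) (sP n)).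
  rewrite -completion_inj_norm completion_injD completion_injN.
  have -> : completion_inj (s m) - completion_inj (s n) =
      - (x - completion_inj (s m)) + (x - completion_inj (s n)).
    by rewrite opprB addrA subrK.
  by apply: le_trans (rnormD _ _) _; rewrite rnormN; exact: lerD.
have s_cauchy : sn_cauchy p s.
  move=> e e0.
  have hs : \forall n \near \oo, h n <= e / 4 by apply: h_small; lra.
  apply: filterS (hs) => n hn; apply: filterS (hs) => m hm.
  by apply: le_trans (s_dist m n) _; lra.
pose u := mk s_cauchy.
apply/cvg_ex; exists (pi u); apply/cvgrPdist_le => _ /complex_gt0E[e e0 ->].
have e2 : 0 < e / 2 by lra.
have e4 : 0 < e / 4 by lra.
near \oo => n.
have un : rnorm (pi u - completion_inj (s n)) <= e / 2.
  by near: n; exact: completion_near_inj.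
have ne : h n <= e / 4 by near: n; exact: h_small.
apply: filterS (sP n) => x xn; rewrite rnormE lecR.
have -> : pi u - x = (pi u - completion_inj (s n)) - (x - completion_inj (s n)).
  by rewrite opprB addrA subrK.
apply: le_trans (rnormD _ _) _; rewrite rnormN.
apply: le_trans (lerD un xn) _; lra.
Unshelve. all: by end_near. Qed.

HB.instance Definition _ := Uniform_isComplete.Build E completion_complete.

Let mulA : associative completion_mul.
Proof.
elim/completionW => u; elim/completionW => v; elim/completionW => w.
by rewrite !mulE; apply: pi_ext => n /=; rewrite bmulA.
Qed.

Let one := completion_inj bone.

Let mul1x : left_id one completion_mul.
Proof.
by elim/completionW => u; rewrite mulE; apply: pi_ext => n /=; rewrite bmul1x.
Qed.

Let mulx1 : right_id one completion_mul.
Proof.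
by elim/completionW => u; rewrite mulE; apply: pi_ext => n /=; rewrite bmulx1.
Qed.

Let mulDl : left_distributive completion_mul +%R.
Proof.
elim/completionW => u; elim/completionW => v; elim/completionW => w.
rewrite -to_completionD !mulE -to_completionD.
by apply: pi_ext => n; exact: bmulDl.
Qed.

Let mulDr : right_distributive completion_mul +%R.
Proof.
elim/completionW => u; elim/completionW => v; elim/completionW => w.
rewrite -to_completionD !mulE -to_completionD.
by apply: pi_ext => n; exact: bmulDr.
Qed.

Let mulZl (c : R[i]) x y : completion_mul (c *: x) y = c *: completion_mul x y.
Proof.
elim/completionW: x => u; elim/completionW: y => v.
rewrite [c *: pi u]scaleE !mulE [RHS]scaleE.
by apply: pi_ext => n; exact: bmulZl.
Qed.

Let mulZr (c : R[i]) x y : completion_mul x (c *: y) = c *: completion_mul x y.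
Proof.
elim/completionW: x => u; elim/completionW: y => v.
rewrite [c *: pi v]scaleE !mulE [RHS]scaleE.
by apply: pi_ext => n; exact: bmulZr.
Qed.

Let normM x y : `|completion_mul x y| <= `|x| * `|y|.
Proof.
rewrite !rnormE -rmorphM /= lecR.
elim/completionW: x => u; elim/completionW: y => v; rewrite mulE.
have uv : p (u n) * p (v n) @[n --> \oo] --> rnorm (pi u) * rnorm (pi v).
  by apply: cvgM; exact: completion_rnorm_cvg.
apply: ler_cvg_to (completion_rnorm_cvg _) uv _.
by near=> n; exact: snM.
Unshelve. all: by end_near. Qed.

Let norm1 : `|one| <= 1.
Proof.
rewrite rnormE -[leRHS]/(1%:C%C) lecR completion_inj_norm.
by apply: le_trans (sn_norm p _) _; rewrite -lecR -rnormE bnorm1.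
Qed.

Let cstarK : involutive completion_star.
Proof.
by elim/completionW => u; rewrite !starE; apply: pi_ext => n /=; rewrite starK.
Qed.

Let cstarD : {morph completion_star : x y / x + y}.
Proof.
elim/completionW => u; elim/completionW => v.
rewrite -to_completionD !starE -to_completionD.
by apply: pi_ext => n; exact: starD.
Qed.

Let cstarZ (c : R[i]) x :
  completion_star (c *: x) = Num.conj c *: completion_star x.
Proof.
elim/completionW: x => u.
rewrite [c *: pi u]scaleE !starE [RHS]scaleE.
by apply: pi_ext => n; exact: starZ.
Qed.

Let cstarM x y :
  completion_star (completion_mul x y) =
  completion_mul (completion_star y) (completion_star x).
Proof.
elim/completionW: x => u; elim/completionW: y => v.
rewrite mulE !starE mulE.
by apply: pi_ext => n; exact: starM.
Qed.

Let cnorm_star x : `|completion_star x| = `|x|.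
Proof.
rewrite !rnormE; elim/completionW: x => u; rewrite starE; congr (_%:C%C).
apply: (cvg_unique _ (completion_rnorm_cvg _)) => //.
rewrite (_ : (fun n => _) = fun n => p (u n)).
  exact: completion_rnorm_cvg.
by apply/funext => n; exact: sn_star.
Qed.

HB.instance Definition _ := isBanachStarAlgebra.Build R[i] E
  mulA mul1x mulx1 mulDl mulDr mulZl mulZr normM norm1
  cstarK cstarD cstarZ cstarM cnorm_star.

Let cstar_id x : `|star x ** x| = `|x| ^+ 2.
Proof.
rewrite !rnormE -rmorphXn /=; elim/completionW: x => u.
rewrite [star _]starE [_ ** _]mulE; congr (_%:C%C).
apply: (cvg_unique _ (completion_rnorm_cvg _)) => //.
rewrite (_ : (fun n => _) = fun n => p (u n) * p (u n)).
  by rewrite expr2; apply: cvgM; exact: completion_rnorm_cvg.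
by apply/funext => n; rewrite -expr2 -sn_cstar.
Qed.

HB.instance Definition _ := hasCStarIdentity.Build R[i] E cstar_id.

Lemma completion_inj_hom : is_star_hom completion_inj.
Proof.
split=> [c b d||b d|b] //.
- rewrite completion_injD; congr (_ + _); rewrite [RHS]scaleE.
  exact: pi_ext.
- by rewrite [RHS]mulE; exact: pi_ext.
- by rewrite [RHS]starE; exact: pi_ext.
Qed.

Lemma completion_commutative : alg_commutative B -> alg_commutative E.
Proof.
move=> Bc; elim/completionW => u; elim/completionW => v.
by rewrite [LHS]mulE [RHS]mulE; apply: pi_ext => n; exact: Bc.
Qed.

End CompletionStructure.

Section StarHom.
Variables (R : realType) (A B : banachStarAlgType R[i]) (f : A -> B).
Hypothesis fhom : is_star_hom f.

Lemma star_homD : {morph f : x y / x + y}.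
Proof. by case: fhom => fl _ _ _ x y; rewrite -[x]scale1r fl !scale1r. Qed.

Lemma star_hom0 : f 0 = 0.
Proof. by apply: (addrI (f 0)); rewrite -star_homD !addr0. Qed.

Lemma star_homZ (c : R[i]) x : f (c *: x) = c *: f x.
Proof.
by case: fhom => fl _ _ _; rewrite -[c *: x]addr0 fl star_hom0 addr0.
Qed.

Lemma star_homN : {morph f : x / - x}.
Proof. by move=> x; rewrite -scaleN1r star_homZ scaleN1r. Qed.

Lemma star_homB : {morph f : x y / x - y}.
Proof. by move=> x y; rewrite star_homD star_homN. Qed.

End StarHom.

(** * Extension of homomorphisms to the completion *)

Section Extension.
Local Open Scope classical_set_scope.
Variables (R : realType) (B : banachStarAlgType R[i]) (p : cstar_seminorm B).
Variables (X : banachStarAlgType R[i]).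
Local Notation E := (completion p).
Local Notation inj := (@completion_inj R B p).

Let injB b c : inj (b - c) = inj b - inj c.
Proof. exact: star_homB (completion_inj_hom p) b c. Qed.

(** The restriction e <= 1 lets an approximant within e of x be bounded by |x| + 1, which keeps the
    error of a product linear in e. The denominator [|c| + 1] is positive for any sign of c. *)
Let eq_small (x y : X) (c : R) :
  (forall e, 0 < e -> e <= 1 -> rnorm (x - y) <= c * e) -> x = y.
Proof.
move=> xy; apply/eqP; rewrite -subr_eq0; apply/eqP/rnorm_eq0/le_anti.
rewrite rnorm_ge0 andbT; apply/ler_addgt0Pr => e e0; rewrite add0r.
pose d := Num.min 1 (e / (`|c| + 1)).
have c0 : 0 < `|c| + 1 by rewrite ltr_wpDl.
have d0 : 0 < d by rewrite lt_min ltr01 divr_gt0.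
have d1 : d <= 1 by rewrite ge_min lexx.
apply: le_trans (xy d d0 d1) _.
apply: le_trans (_ : (`|c| + 1) * d <= _).
  by rewrite ler_wpM2r ?(ltW d0) //; have := ler_norm c; lra.
by rewrite mulrC -ler_pdivlMr // ge_min lexx orbT.
Qed.

(** The image of B is dense, and |g x - h x| <= 2 |x - inj b| for every b, because g and h are
    contractions that agree at b. *)
Lemma completion_hom_unique (g h : E -> X) :
  is_star_hom g -> contractive g -> is_star_hom h -> contractive h ->
  (forall b, g (inj b) = h (inj b)) -> g = h.
Proof.
move=> gs /contractiveE gc hs /contractiveE hc gh; apply/funext => x.
apply: (@eq_small _ _ 2) => e e0 _; have [b xb] := completion_dense x e0.
have -> : g x - h x = g (x - inj b) - h (x - inj b).
  by rewrite (star_homB gs) (star_homB hs) gh opprB addrA subrK.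
apply: le_trans (rnormD _ _) _; rewrite rnormN.
by have := gc (x - inj b); have := hc (x - inj b); lra.
Qed.

Variable f : B -> X.
Hypothesis fhom : is_star_hom f.
Hypothesis fp : forall b, rnorm (f b) <= p b.

Let f_dist b c : rnorm (f b - f c) <= rnorm (inj b - inj c).
Proof. by rewrite -(star_homB fhom) -injB completion_inj_norm. Qed.

(** The point z is the limit of f along a sequence representing x, which is Cauchy since f is
    bounded by p. The inequality describes z without reference to that sequence. *)
Let ext_exists (x : E) :
  exists z : X, forall b, rnorm (z - f b) <= rnorm (x - inj b).
Proof.
elim/completionW: x => u.
have : cauchy ((fun n => f (u n)) @ \oo).
  apply/cauchy_exP => _ /complex_gt0E[e e0 ->]; have e2 : 0 < e / 2 by lra.
  near \oo => n; exists (f (u n)).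
  have un : \forall m \near \oo, p (u m - u n) <= e / 2.
    by near: n; have /asboolP/(_ _ e2) := cseqP u.
  apply: filterS un => m um; rewrite -ball_normE /= distrC rnormE ltcR.
  rewrite -(star_homB fhom); apply: le_lt_trans (fp _) _.
  by apply: le_lt_trans um _; lra.
move=> /cauchy_cvg/cvg_ex[z /cvgrPdist_le uz]; exists z => b.
apply/ler_addgt0Pr => e e0; have e2 : 0 < e / 2 by lra.
near \oo => n.
have zn : rnorm (z - f (u n)) <= e / 2.
  rewrite -lecR -rnormE; near: n; apply: uz.
  by rewrite -[ltLHS]/(0%:C%C) ltcR.
have un : rnorm (to_completion u - inj (u n)) <= e / 2.
  by near: n; exact: completion_near_inj.
have -> : z - f b = (z - f (u n)) + (f (u n) - f b) by rewrite addrA subrK.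
have fd := f_dist (u n) b; apply: le_trans (rnormD _ _) _.
have : rnorm (inj (u n) - inj b) <= e / 2 + rnorm (to_completion u - inj b).
  rewrite (_ : inj (u n) - inj b =
    - (to_completion u - inj (u n)) + (to_completion u - inj b)).
    by apply: le_trans (rnormD _ _) _; rewrite rnormN lerD2r.
  by rewrite opprB addrA subrK.
lra.
Unshelve. all: by end_near. Qed.

(* The extension g is determined by |g x - f b| <= |x - b| for all b in B. *)
Lemma completion_extension : exists g : E -> X,
  [/\ is_star_hom g, contractive g & forall b, g (inj b) = f b].
Proof.
have [g gf] := choice ext_exists; exists g.
have gE b : g (inj b) = f b.
  apply/eqP; rewrite -subr_eq0; apply/eqP/rnorm_eq0/le_anti.
  by rewrite rnorm_ge0 andbT; have := gf (inj b) b; rewrite subrr rnorm0.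
have [fl f1 fM fS] := fhom; have [il i1 iM iS] := completion_inj_hom p.
split=> //; last first.
  apply/contractiveE => x; have := gf x 0.
  by rewrite (star_hom0 fhom) (star_hom0 (completion_inj_hom p)) !subr0.
split=> [c x y||x y|x].
(* Both [g (c *: x + y)] and [c *: g x + g y] are within (|c| + 1) e of [f (c *: b + d)], where b
   and d approximate x and y. *)
- apply: (@eq_small _ _ (2 * (modulus c + 1))) => e e0 _.
  have [b xb] := completion_dense x e0; have [d yd] := completion_dense y e0.
  have gx := le_trans (gf x b) xb; have gy := le_trans (gf y d) yd.
  have -> : g (c *: x + y) - (c *: g x + g y) =
      (g (c *: x + y) - f (c *: b + d)) - (c *: (g x - f b) + (g y - f d)).
    by rewrite fl scalerBr addrACA -opprD opprB subrKA.
  apply: le_trans (rnormD _ _) _; rewrite rnormN.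
  have h1 : rnorm (c *: (g x - f b) + (g y - f d)) <= modulus c * e + e.
    apply: le_trans (rnormD _ _) _; rewrite rnormZ lerD //.
    by rewrite ler_wpM2l ?modulus_ge0.
  have h2 : rnorm (g (c *: x + y) - f (c *: b + d)) <= modulus c * e + e.
    apply: le_trans (gf _ _) _; rewrite il opprD addrACA -scalerBr.
    apply: le_trans (rnormD _ _) _; rewrite rnormZ lerD //.
    by rewrite ler_wpM2l ?modulus_ge0.
  lra.
- by rewrite -f1 -gE.
(* The two halves of the constant come from [split_mul], applied once in the completion and once in
   X. In both, |x| + 1 bounds the approximant of the left factor. *)
- apply: (@eq_small _ _ (rnorm x + 1 + rnorm y + (rnorm x + 1 + rnorm (g y)))).
  move=> e e0 e1.
  have [b xb] := completion_dense x e0; have [d yd] := completion_dense y e0.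
  have gx := le_trans (gf x b) xb; have gy := le_trans (gf y d) yd.
  have ib : rnorm (inj b) <= rnorm x + 1.
    rewrite -[inj b](subrK x) addrC; apply: le_trans (rnormD _ _) _.
    by rewrite lerD2l -rnormN opprB; lra.
  have fb : rnorm (f b) <= rnorm x + 1.
    by apply: le_trans (fp b) _; rewrite -completion_inj_norm.
  have split_mul (A : banachStarAlgType R[i]) (s t s' t' : A) (k : R) :
      rnorm s' <= k -> rnorm (s - s') <= e -> rnorm (t - t') <= e ->
      rnorm (s ** t - s' ** t') <= (k + rnorm t) * e.
    move=> s'k se te.
    have -> : s ** t - s' ** t' = s' ** (t - t') + (s - s') ** t.
      by rewrite bmulDr bmulDl bmulxN bmulNx [RHS]addrC subrKA.
    rewrite mulrDl; apply: le_trans (rnormD _ _) _; apply: lerD.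
      by apply: le_trans (rnormM _ _) _; apply: ler_pM; rewrite ?rnorm_ge0.
    rewrite mulrC; apply: le_trans (rnormM _ _) _.
    by apply: ler_pM; rewrite ?rnorm_ge0.
  have -> : g (x ** y) - g x ** g y =
      (g (x ** y) - f (b ** d)) - (g x ** g y - f b ** f d).
    by rewrite fM opprB addrA subrK.
  apply: le_trans (rnormD _ _) _; rewrite rnormN mulrDl; apply: lerD.
    by apply: le_trans (gf _ _) _; rewrite iM; exact: split_mul.
  exact: split_mul.
- apply: (@eq_small _ _ 2) => e e0 _.
  have [b xb] := completion_dense x e0; have gx := le_trans (gf x b) xb.
  have -> : g (star x) - star (g x) =
      (g (star x) - f (star b)) - star (g x - f b).
    by rewrite starD starN fS opprB addrA subrK.
  apply: le_trans (rnormD _ _) _; rewrite rnormN rnorm_star.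
  have : rnorm (g (star x) - f (star b)) <= e.
    by apply: le_trans (gf _ _) _; rewrite iS -starN -starD rnorm_star.
  lra.
Qed.

End Extension.

(** * The forgetful functors *)

Section CStarReflection.
Variable R : realType.

Lemma completion_inj_contractive (B : banachStarAlgType R[i])
    (p : cstar_seminorm B) : contractive (@completion_inj R B p).
Proof. by apply/contractiveE => b; rewrite completion_inj_norm sn_norm. Qed.

Definition completion_arrow (B : banachStarAlgType R[i])
    (p : cstar_seminorm B) : banstar_hom B (completion p) :=
  exist _ (@completion_inj R B p)
    (conj (completion_inj_hom p) (completion_inj_contractive p)).

(** Serves both constructions: the reflection, with p the largest seminorm, and the coequalizer,
    with p a quotient seminorm. The target is any Banach star algebra. *)
Lemma completion_universal (B X : banachStarAlgType R[i])
    (p : cstar_seminorm B) (f : banstar_hom B X) :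
  (forall b, rnorm (sval f b) <= p b) ->
  exists! g : banstar_hom (completion p) X,
    banstar_comp g (completion_arrow p) = f.
Proof.
move=> fp; have [g [gs gc gE]] := completion_extension (svalP f).1 fp.
exists (exist _ g (conj gs gc)); split=> [|h hf].
  by apply: banstar_hom_inj; apply/funext => b; exact: gE.
apply: banstar_hom_inj => /=.
apply: (completion_hom_unique gs gc (svalP h).1 (svalP h).2) => b.
by rewrite gE -hf.
Qed.

Section PullbackSeminorm.
Variables (B : banachStarAlgType R[i]) (A : cstarAlgType R[i]).
Variable f : banstar_hom B A.

(** A morphism to a C*-algebra thus contributes to the supremum defining the largest seminorm, and
    so is bounded by it. *)
Definition pullback_seminorm : cstar_seminorm B.
Proof.
apply: (@CstarSeminorm R B (fun b => rnorm (sval f b))).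
- by move=> x y; rewrite (star_homD (svalP f).1) rnormD.
- by move=> c x; rewrite (star_homZ (svalP f).1) rnormZ.
- by case: (svalP f) => -[_ _ fM _] _ x y; rewrite fM rnormM.
- by case: (svalP f) => -[_ _ fM fS] _ x; rewrite fM fS rnorm_cstar.
- by apply/contractiveE; case: (svalP f).
Defined.

End PullbackSeminorm.

Lemma largest_universal (B : banachStarAlgType R[i]) (A : cstarAlgType R[i])
    (f : banstar_hom B A) :
  exists! g : banstar_hom (completion (largest_seminorm B)) A,
    banstar_comp g (completion_arrow (largest_seminorm B)) = f.
Proof.
apply: completion_universal => b.
exact: (largest_seminorm_ge (pullback_seminorm f)).
Qed.

(** * Coequalizers of reflexive pairs *)

Section ReflexiveCoequalizer.
Variables (A B : cstarAlgType R[i]) (d0 d1 : cstar_hom A B).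
Variable t : cstar_hom B A.
Hypotheses (d0t : forall b, sval d0 (sval t b) = b)
           (d1t : forall b, sval d1 (sval t b) = b).

(* Because of the common section, the differences d0 a - d1 a already form an
   ideal: b (d0 a - d1 a) = d0 (t b a) - d1 (t b a). *)
Definition difference_set : set B :=
  fun b => exists a, b = sval d0 a - sval d1 a.

Lemma difference_ideal : star_ideal difference_set.
Proof.
have [d0s d1s] := (svalP d0, svalP d1).
have [[_ _ d0M d0S] [_ _ d1M d1S]] := (d0s, d1s).
split.
- by exists 0; rewrite (star_hom0 d0s) (star_hom0 d1s) subrr.
- move=> _ _ [a ->] [c ->]; exists (a + c).
  by rewrite (star_homD d0s) (star_homD d1s) addrACA -opprD.
- move=> c _ [a ->]; exists (c *: a).
  by rewrite (star_homZ d0s) (star_homZ d1s) scalerBr.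
- move=> b _ [a ->]; exists (sval t b ** a).
  by rewrite d0M d1M d0t d1t bmulDr bmulxN.
- move=> _ b [a ->]; exists (a ** sval t b).
  by rewrite d0M d1M d0t d1t bmulDl bmulNx.
- by move=> _ [a ->]; exists (star a); rewrite d0S d1S starD starN.
Qed.

(** A morphism f that coequalizes the pair vanishes on the differences, so |f b| = |f (b + j)| <= |b
    + j| for each difference j. Hence f is bounded by the quotient seminorm and extends uniquely to
    the completion. *)
Lemma reflexive_coequalizer :
  @is_coequalizer (BanAlgStar1 R) _ _ (forget_hom d0) (forget_hom d1) _
    (completion_arrow (ideal_seminorm difference_ideal)).
Proof.
split=> [|X f fd].
  apply: banstar_hom_inj; apply/funext => a /=.
  apply/eqP; rewrite -subr_eq0 -completion_injN -completion_injD.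
  apply/eqP/rnorm_eq0; rewrite completion_inj_norm.
  by apply: ideal_seminorm_eq0; exists a.
apply: completion_universal => b; apply: ideal_seminormP => _ [a ->].
have /contractiveE fc := (svalP f).2.
apply: le_trans (fc _); rewrite (star_homD (svalP f).1) (star_homB (svalP f).1).
have /(congr1 (fun g => sval g a)) /= -> := fd.
by rewrite subrr addr0.
Qed.

End ReflexiveCoequalizer.

Lemma forget_full (A B : CStar1 R) (g : hom (forget R A) (forget R B)) :
  exists f : hom A B, fmap (forget R) f = g.
Proof.
by exists (exist _ (sval g) (svalP g).1 : hom A B); exact: banstar_hom_inj.
Qed.

Lemma forget_faithful (A B : CStar1 R) : injective (@fmap _ _ (forget R) A B).
Proof. by move=> f g /(congr1 sval) fg; exact: cstar_hom_inj. Qed.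

Lemma forget_left_adjoint : has_left_adjoint (forget R).
Proof.
apply: universal_arrows_left_adjoint => B.
exists (completion (largest_seminorm B) : CStar1 R).
exists (completion_arrow (largest_seminorm B)) => A f.
have [g [gf gu]] := largest_universal f.
have [g' g'E] := forget_full g; exists g'; split=> [|h hf].
  by rewrite g'E.
by apply: forget_faithful; rewrite g'E; exact: gu.
Qed.

End CStarReflection.

(** * Crude tripleability, general and commutative *)

Section Forgetful.
Local Open Scope cat_scope.
Variable R : realType.

Lemma section_pointwise (A B : CStar1 R) (d : hom A B) (t : hom B A) :
  d \c t = idm B -> forall b, sval d (sval t b) = b.
Proof. by move=> dt b; have /(congr1 (fun g => sval g b)) := dt. Qed.

Lemma forget_CTT : CTT (forget R).
Proof.
apply: fully_faithful_CTT; [exact: forget_full|exact: forget_faithful|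
  exact: forget_left_adjoint|].
move=> A B d0 d1 [t [/section_pointwise d0t /section_pointwise d1t]].
pose p := ideal_seminorm (difference_ideal d0t d1t).
pose Q : CStar1 R := completion p.
have [q qE] := @forget_full R B Q (completion_arrow p).
by exists Q, q; rewrite qE; exact: reflexive_coequalizer.
Qed.

Lemma forget_c_full (A B : CStarc1 R) (g : hom (forget_c R A) (forget_c R B)) :
  exists f : hom A B, fmap (forget_c R) f = g.
Proof. exact: (@forget_full R (sval A) (sval B) g). Qed.

Lemma forget_c_faithful (A B : CStarc1 R) :
  injective (@fmap _ _ (forget_c R) A B).
Proof. exact: (@forget_faithful R (sval A) (sval B)). Qed.

(** The general reflection restricts, since the completion of a commutative algebra is commutative
    and the subcategories are full. *)
Lemma forget_c_left_adjoint : has_left_adjoint (forget_c R).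
Proof.
apply: universal_arrows_left_adjoint => -[B Bc].
pose F : CStarc1 R := exist (fun A : CStar1 R => alg_commutative A)
  (completion (largest_seminorm B) : CStar1 R) (completion_commutative Bc).
exists F, (completion_arrow (largest_seminorm B)) => A f.
have [g [gf gu]] := largest_universal (f : banstar_hom B (sval A)).
have [g' g'E] := @forget_c_full F A g; exists g'; split=> [|h hf].
  by rewrite g'E.
by apply: (@forget_c_faithful F A); rewrite g'E; exact: gu.
Qed.

Lemma forget_c_CTT : CTT (forget_c R).
Proof.
apply: fully_faithful_CTT; [exact: forget_c_full|exact: forget_c_faithful|
  exact: forget_c_left_adjoint|].
move=> A B d0 d1 [t [d0t d1t]].
have {}d0t := @section_pointwise (sval A) (sval B) d0 t d0t.
have {}d1t := @section_pointwise (sval A) (sval B) d1 t d1t.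
pose p := ideal_seminorm (difference_ideal d0t d1t).
pose Q : CStarc1 R := exist (fun A : CStar1 R => alg_commutative A)
  (completion p : CStar1 R) (completion_commutative (svalP B)).
have [q qE] := @forget_c_full B Q (completion_arrow p).
exists Q, q; rewrite qE.
(* The coequalizer among all Banach star algebras is commutative, so it is also one in the full
   subcategory. *)
have [eqd univ] := reflexive_coequalizer d0t d1t.
by split=> [|X f fd]; [exact: eqd|exact: (univ (sval X) f fd)].
Qed.

End Forgetful.

Theorem theorem2p4 (R : realType) :
  (CTT (forget R) /\ monadic (forget R)) /\
  (CTT (forget_c R) /\ monadic (forget_c R)).
Proof.
split; split; [exact: forget_CTT| |exact: forget_c_CTT|].
  apply: fully_faithful_monadic; [exact: forget_full|exact: forget_faithful|].
  exact: forget_left_adjoint.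
apply: fully_faithful_monadic; [exact: forget_c_full|exact: forget_c_faithful|].
exact: forget_c_left_adjoint.
Qed.
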